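(* There is a set of rigidity $S\subseteq\mathbb Z$ such that $S$ is dense in the Bohr topology of $\mathbb Z$.
   Context: A set $S\subseteq\mathbb Z$ is a set of rigidity if $S$ is infinite and there is a nontrivial ergodic measure preserving system $(X,\mu,T)$ (probability space, invertible measure preserving $T$) such that for all measurable $D\subseteq X$ and all $\varepsilon>0$ the set $\{n\in S:\mu(D\triangle T^nD)>\varepsilon\}$ is finite. The Bohr topology on $\mathbb Z$ is the weakest topology making every homomorphism $\chi:\mathbb Z\to\mathbb T=\mathbb R/\mathbb Z$ continuous. *)

(* Defs.v *)
From HB Require Import structures.
From mathcomp Require Import all_boot all_order all_algebra.
From mathcomp Require Import all_classical all_reals all_analysis.
Set Implicit Arguments.
Unset Strict Implicit.
Unset Printing Implicit Defensive.
Import Order.TTheory GRing.Theory Num.Theory.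
Local Open Scope classical_set_scope.
Local Open Scope ring_scope.

Section Bohr.
Variable R : realType.

Definition tnorm (x : R) : R :=
  Num.min (x - (Num.floor x)%:~R) ((Num.floor x)%:~R + 1 - x).

(* a homomorphism Z -> T = R/Z, represented by a real-valued lift *)
Definition torus_hom (chi : int -> R) : Prop :=
  forall a b : int, exists k : int, chi (a + b) = chi a + chi b + k%:~R.

(* open sets of the Bohr topology (initial topology of all homomorphisms
   Z -> T): every point has a basic neighbourhood
   {n | ||chi_i n - chi_i m|| < eps, i < k} contained in U *)
Definition bohr_open (U : set int) : Prop :=
  forall m, U m -> exists (k : nat) (chi : 'I_k -> int -> R) (eps : R),
    0 < eps /\ (forall i, torus_hom (chi i)) /\
    (forall n, (forall i, tnorm (chi i n - chi i m) < eps) -> U n).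

Definition bohr_dense (S : set int) : Prop :=
  forall U, bohr_open U -> U !=set0 -> (S `&` U) !=set0.
End Bohr.

Section MPS.
Variables (R : realType) (d : measure_display) (X : measurableType d).

Definition tpow (T Tinv : X -> X) (n : int) : X -> X :=
  match n with Posz k => iter k T | Negz k => iter k.+1 Tinv end.

Definition inv_mps (mu : probability X R) (T Tinv : X -> X) : Prop :=
  [/\ measurable_fun setT T, measurable_fun setT Tinv,
      cancel T Tinv, cancel Tinv T &
      forall A, measurable A -> mu (T @^-1` A) = mu A].

Definition ergodic (mu : probability X R) (T : X -> X) : Prop :=
  forall A, measurable A -> T @^-1` A = A -> mu A = 0%E \/ mu A = 1%E.

Definition nontrivial (mu : probability X R) : Prop :=
  exists A, measurable A /\ (0 < mu A)%E /\ (mu A < 1)%E.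

Definition symdiff (A B : set X) : set X := (A `\` B) `|` (B `\` A).

Definition rigid_along (S : set int) (mu : probability X R) (T Tinv : X -> X) : Prop :=
  forall D, measurable D -> forall eps : R, 0 < eps ->
    finite_set [set n | S n /\ (eps%:E < mu (symdiff D (tpow T Tinv n @` D)))%E].
End MPS.

Definition set_of_rigidity (R : realType) (S : set int) : Prop :=
  ~ finite_set S /\
  exists (d : measure_display) (X : measurableType d) (mu : probability X R)
         (T Tinv : X -> X),
    [/\ inv_mps mu T Tinv, ergodic mu T, nontrivial mu & rigid_along S mu T Tinv].

(* Main.v *)
Require Import Defs.
From HB Require Import structures.
From mathcomp Require Import all_boot all_order all_algebra.
From mathcomp Require Import ring lra zify.
From mathcomp Require Import all_classical all_reals all_analysis.
Set Implicit Arguments.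
Unset Strict Implicit.
Unset Printing Implicit Defensive.
Import Order.TTheory GRing.Theory Num.Theory.
Local Open Scope ring_scope.

(** A tower over the 2-adic odometer is built so that at stage [k] it consists of [2 ^ k]
    long chunks of columns, all columns of chunk [j] having the same height [H k j], and
    the heights [H k j], [j < 2 ^ k], being pairwise coprime.  If [n] is bounded by a
    quantity [B k] much smaller than the length of a chunk, and all but [2 k ^ 2] of the
    [H k j] divide [n], then on most of the space the [n]-th iterate only moves points by
    whole columns, so that it is close to the identity; the set [S] of all such [n] is
    therefore a set of rigidity.  Ergodicity is inherited from the odometer.

    For Bohr density write, by Bezout, [m = sum_j w j] where [H k i] divides [w j] for all
    [i <> j].  Given [q <= k] characters, let [J] be a maximal set of indices for which
    the subset sums of the [w j] are [4 ^- k]-separated by the characters.  Counting boxes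
    gives [#|J| <= 2 k q <= 2 k ^ 2], and by maximality every [w j] is, up to [4 ^- k], a
    combination of the [w i], [i] in [J], with coefficients in {-1, 0, 1}.  Summing over [j]
    yields an integer [n] that is Bohr-close to [m] and divisible by all [H k i] with [i]
    outside [J]. *)

(** * Approximate integrality and homomorphisms to the circle *)

Section BohrStage.
Variable R : realType.

(** Closeness modulo 1 with an explicit integer witness: tolerances add and integer shifts are
    absorbed. It is turned into [tnorm] by [tnorm_lt]. *)
Definition near_int (e x : R) : Prop := exists z : int, `|x - z%:~R| <= e.

Lemma near_intD e e' x y :
  near_int e x -> near_int e' y -> near_int (e + e') (x + y).
Proof.
move=> [z hz] [z' hz']; exists (z + z'); rewrite rmorphD /=.
have -> : x + y - (z%:~R + z'%:~R) = (x - z%:~R) + (y - z'%:~R) by ring.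
by apply: le_trans (ler_normD _ _) _; apply: lerD.
Qed.

Lemma near_int_shift e x y :
  (exists z : int, y = x + z%:~R) -> near_int e x -> near_int e y.
Proof.
move=> [z ->] [z' h]; exists (z + z'); rewrite rmorphD /=.
suff -> : x + z%:~R - (z%:~R + z'%:~R) = x - z'%:~R by []; ring.
Qed.

Lemma near_intN e x : near_int e x -> near_int e (- x).
Proof.
move=> [z h]; exists (- z); rewrite rmorphN /=.
by rewrite -opprD normrN.
Qed.

(** Any integer is at most floor x or at least floor x + 1, hence no closer to x than the
    corresponding term of the minimum. *)
Lemma tnorm_lt e e' x : near_int e x -> e < e' -> tnorm x < e'.
Proof.
move=> [z h] he; rewrite /tnorm.
have /andP[h1 h2] := floor_itv x.
apply: le_lt_trans he; rewrite ge_min.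
have [hz|hz] := leP z (Num.floor x).
  apply/orP; left; apply: le_trans h.
  have : (z%:~R : R) <= (Num.floor x)%:~R by rewrite ler_int.
  by move=> hf; rewrite ger0_norm; lra.
apply/orP; right; apply: le_trans h.
have : (Num.floor x + 1)%:~R <= (z%:~R : R) by rewrite ler_int lezD1.
rewrite rmorphD /= in h2; rewrite rmorphD /= => hf; rewrite ler0_norm; lra.
Qed.

Section Hom.
Variables (chi : int -> R) (hchi : torus_hom chi).

Lemma torus_hom_nearD e e' a b :
  near_int e (chi a) -> near_int e' (chi b) -> near_int (e + e') (chi (a + b)).
Proof.
move=> ha hb; have [z hz] := hchi a b.
by apply: near_int_shift (near_intD ha hb); exists z.
Qed.

Lemma torus_hom_near0 : near_int 0 (chi 0).
Proof.
have [z] := hchi 0 0; rewrite addr0 => hz.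
exists (- z); rewrite rmorphN /= normr_le0; apply/eqP; lra.
Qed.

Lemma torus_homB a b : exists z : int, chi (a - b) = chi a - chi b + z%:~R.
Proof.
have [z hz] := hchi (a - b) b; exists (- z); rewrite rmorphN /=.
rewrite subrK in hz; lra.
Qed.

Lemma torus_hom_nearN e a : near_int e (chi a) -> near_int e (chi (- a)).
Proof.
move=> h; have [z hz] := torus_homB 0 a; rewrite sub0r in hz.
have [w hw] := torus_hom_near0.
rewrite normr_le0 subr_eq0 in hw.
apply: near_int_shift (near_intN h); exists (w + z).
by rewrite hz (eqP hw) rmorphD /=; ring.
Qed.

Lemma torus_hom_near_sum (I : finType) e (F : I -> int) :
  (forall i, near_int e (chi (F i))) ->
  near_int (#|I|%:R * e) (chi (\sum_i F i)).
Proof.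
move=> h; rewrite cardE -big_enum.
elim: (enum I) => [|i s IH]; first by rewrite big_nil mul0r; exact: torus_hom_near0.
rewrite big_cons /= -addn1 natrD mulrDl mul1r addrC.
exact: torus_hom_nearD.
Qed.

End Hom.

(** * Pigeonhole boxes on the circle *)

Definition box (K : nat) (x : R) : nat :=
  Num.truncn (K%:R * (x - (Num.floor x)%:~R)).

Lemma box_lt K x : (0 < K)%N -> (box K x < K)%N.
Proof.
move=> K0; have /andP[h1 h2] := floor_itv x.
rewrite rmorphD /= in h2.
have K0' : 0 < K%:R :> R by rewrite ltr0n.
have g0 : 0 <= K%:R * (x - (Num.floor x)%:~R) by rewrite mulr_ge0 ?ler0n// subr_ge0.
have /andP[t1 t2] := truncn_itv g0.
rewrite -(ltr_nat R); apply: le_lt_trans t1 _.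
rewrite -[X in _ < X]mulr1 ltr_pM2l//; lra.
Qed.

Lemma box_near K x x' : (0 < K)%N -> box K x = box K x' ->
  near_int (K%:R^-1) (x - x').
Proof.
move=> K0 bb; have /andP[h1 h2] := floor_itv x.
have /andP[h1' h2'] := floor_itv x'.
have K0' : 0 < K%:R :> R by rewrite ltr0n.
have g0 : 0 <= K%:R * (x - (Num.floor x)%:~R) by rewrite mulr_ge0 ?ler0n// subr_ge0.
have g0' : 0 <= K%:R * (x' - (Num.floor x')%:~R) by rewrite mulr_ge0 ?ler0n// subr_ge0.
have /andP[t1 t2] := truncn_itv g0.
have /andP[t1' t2'] := truncn_itv g0'.
rewrite -!/(box _ _) -bb -addn1 natrD in t1 t2 t1' t2'.
exists (Num.floor x - Num.floor x'); rewrite rmorphB /=.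
rewrite -(ler_pM2l K0') mulfV ?gt_eqF// -[X in X * _](gtr0_norm K0') -normrM.
rewrite ler_norml; apply/andP; split; lra.
Qed.

(** * Bezout coefficients for pairwise coprime families *)

Lemma coprime_bezout_sum (I : eqType) (H : I -> nat) (s : seq I) :
  uniq s -> s != [::] ->
  {in s &, forall i j, i != j -> coprime (H i) (H j)} ->
  exists y : I -> int, \sum_(i <- s) y i = 1 /\
    {in s &, forall i j, i != j -> (H i %| y j)%Z}.
Proof.
elim: s => // a s IH /= /andP[as' us] _ cop.
have [->|sn] := eqVneq s [::].
  exists (fun=> 1); rewrite big_seq1; split => // i j.
  by rewrite !inE => /eqP -> /eqP ->; rewrite eqxx.
have [y [ysum ydiv]] : exists y : I -> int, \sum_(i <- s) y i = 1 /\
    {in s &, forall i j, i != j -> (H i %| y j)%Z}.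
  apply: IH => // i j hi hj; apply: cop; rewrite inE ?hi ?hj orbT //.
pose P := (\prod_(i <- s) H i)%N.
have copP : coprime (H a) P.
  rewrite /P big_seq; elim/big_ind: _ => [|x x'|i hi]; first exact: coprimen1.
    by move=> h h'; rewrite coprimeMr h.
  apply: cop; rewrite ?inE ?eqxx ?hi ?orbT //.
  by apply: contraNneq as' => ->.
have [u [v uv]] : exists u v : int, u * (H a)%:Z + v * P%:Z = 1.
  have := Bezoutz (H a)%:Z P%:Z => -[u [v]].
  rewrite (eqP (_ : gcdz (H a) P == 1)); first by exists u, v.
  by rewrite /gcdz !absz_nat.
(* The new index receives v P, which every old height divides; the old coefficients, of sum 1, are
   scaled by u H(a). The total is the Bezout identity. *)
exists (fun i => if i == a then v * P%:Z else u * (H a)%:Z * y i); split.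
  rewrite big_cons eqxx.
  rewrite (eq_big_seq (fun i => u * (H a)%:Z * y i)); last first.
    by move=> i hi /=; case: eqP => // e; rewrite -e hi in as'.
  by rewrite -big_distrr /= ysum mulr1 addrC.
have divP i : i \in s -> ((H i)%:Z %| P%:Z)%Z.
  by move=> hi; rewrite /P dvdzE /= (big_rem i)//= dvdn_mulr.
move=> i j; rewrite !inE => /predU1P[->|hi] /predU1P[->|hj] ij.
- by rewrite eqxx in ij.
- by rewrite eq_sym (negbTE ij) dvdz_mulr// dvdz_mull.
- by rewrite eqxx dvdz_mull// divP.
- case: eqP => [e|_]; first by rewrite -e hj in as'.
  by rewrite dvdz_mull// ydiv.
Qed.

(** * Dissociated index sets *)

Section Dissociated.
Variables (I : finType) (q K : nat) (chi : 'I_q -> int -> R).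
Hypotheses (K0 : (0 < K)%N) (hchi : forall i, torus_hom (chi i)).
Variable w : I -> int.

Local Notation e := (K%:R^-1 : R).
Let W (A : {set I}) : int := \sum_(i in A) w i.
Definition all_near (x : int) := forall i, near_int e (chi i x).

(** A quantitative form of dissociativity, made boolean so that [arg_maxnP] can select a maximal
    set. *)
Definition dissociated (J : {set I}) : bool :=
  `[< forall A B : {set I}, A \subset J -> B \subset J ->
       all_near (W A - W B) -> A = B >].

(** Separated subset sums fall into distinct boxes of the q-dimensional torus, of which there are K
    ^ q. *)
Lemma dissociated_card J : dissociated J -> (2 ^ #|J| <= K ^ q)%N.
Proof.
move/asboolP => dJ; rewrite -card_powerset.
pose f (A : {set I}) : {ffun 'I_q -> 'I_K} :=
  [ffun i => Ordinal (box_lt (chi i (W A)) K0)].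
have -> : (K ^ q = #|{ffun 'I_q -> 'I_K}|)%N by rewrite card_ffun !card_ord.
rewrite -(card_in_imset (f := f)); first exact: max_card.
move=> A B; rewrite !powersetE => AJ BJ /ffunP fAB.
apply: dJ => // i; have := fAB i; rewrite !ffunE => /(congr1 val) /= /(box_near K0).
by apply: near_int_shift; apply: torus_homB.
Qed.

(* A sum over two sets A, B of J + j that are close must involve j exactly once,
   otherwise cancelling j would contradict dissociativity of J. *)
Lemma maximal_dissociated_span : exists J : {set I}, (2 ^ #|J| <= K ^ q)%N /\
  forall j, exists c : I -> int, (forall i, `|c i| <= 1) /\
    all_near (w j - \sum_(i in J) c i * w i).
Proof.
have d0 : dissociated finset.set0.
  by apply/asboolP => A B; rewrite !finset.subset0 => /eqP -> /eqP ->.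
case: (arg_maxnP (fun J : {set I} => #|J|) d0) => J dJ maxJ.
exists J; split; first exact: dissociated_card.
have e0 : 0 <= e by rewrite invr_ge0 ler0n.
have near0 : all_near 0.
  by move=> i; have [z hz] := torus_hom_near0 (hchi i); exists z; apply: le_trans e0.
move=> j; have [jJ|jJ] := boolP (j \in J).
  exists (fun i => (i == j)%:R); split; first by move=> i; case: eqP.
  rewrite (bigD1 j)//= eqxx mul1r big1 ?addr0 ?subrr// => i /andP[_ /negbTE ->].
  by rewrite mul0r.
have : ~~ dissociated (j |: J).
  by apply/negP => /maxJ; rewrite cardsU1 jJ /= add1n ltnn.
move/asboolPn; move/existsNP => [A /existsNP[B]] /not_implyP[AJ] /not_implyP[BJ].
move=> /not_implyP[nAB AB].
(* When j lies in C but not in D, solving W C - W D for w j leaves the coefficients 1_D - 1_C on J,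
   which lie in {-1, 0, 1}. *)
have key (C D : {set I}) : C \subset j |: J -> D \subset j |: J -> j \in C ->
    j \notin D -> all_near (W C - W D) -> exists c : I -> int, (forall i, `|c i| <= 1) /\
    all_near (w j - \sum_(i in J) c i * w i).
  move=> CJ DJ jC jD nCD.
  exists (fun i => (i \in D)%:R - (i \in C)%:R); split.
    by move=> i; case: (i \in D); case: (i \in C).
  rewrite (_ : w j - _ = W C - W D)//.
  under eq_bigr do rewrite mulrBl.
  rewrite sumrB opprB addrA.
  have sub (E : {set I}) : E \subset j |: J -> \sum_(i in J) (i \in E)%:R * w i
      = \sum_(i in E :\ j) w i.
    move=> EJ; rewrite (bigID (mem E)) /= [X in _ + X]big1 ?addr0; last first.
      by move=> i /andP[_ /negbTE ->]; rewrite mul0r.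
    apply: eq_big => [i|i /andP[_ ->]]; last by rewrite mul1r.
    rewrite !inE andbC; have [iE|] := boolP (i \in E); last by rewrite andbF.
    have := fintype.subsetP EJ _ iE; rewrite !inE andbT /=.
    by case: eqP => // -> _; rewrite (negbTE jJ).
  rewrite !sub// /W [in RHS](big_setD1 j)//= .
  by congr (_ - _); apply: eq_bigl => i; rewrite !inE; case: eqP => // ->; rewrite (negbTE jD).
have symn x y : all_near (x - y) -> all_near (y - x).
  by move=> h i; rewrite -opprB; apply: torus_hom_nearN.
have [jA|jA] := boolP (j \in A); have [jB|jB] := boolP (j \in B).
- case: AB; rewrite -(finset.setD1K jA) -(finset.setD1K jB); congr (_ |: _).
  move/asboolP: dJ; apply; rewrite ?finset.subDset// => i.
  have := nAB i; rewrite /W (finset.big_setD1 _ jA) (finset.big_setD1 _ jB) /=.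
  by rewrite opprD addrACA subrr add0r.
- exact: (key A B).
- by apply: (key B A) => //; apply: symn.
- case: AB; move/asboolP: dJ; apply => //.
  + apply/fintype.subsetP => i iA; have := fintype.subsetP AJ _ iA.
    by rewrite !inE; case: eqP => // e1; rewrite -e1 iA in jA.
  + apply/fintype.subsetP => i iA; have := fintype.subsetP BJ _ iA.
    by rewrite !inE; case: eqP => // e1; rewrite -e1 iA in jB.
Qed.

End Dissociated.

(** * Bohr approximation by integers that almost all heights divide *)

Definition bohr_bounded (k : nat) (H : 'I_(2 ^ k) -> nat) (B : nat) : Prop :=
  forall (q : nat) (chi : 'I_q -> int -> R) (m : int),
  (q <= k)%N -> (`|m| <= k)%N -> (forall i, torus_hom (chi i)) ->
  exists n : int, [/\ (`|n| <= B)%N,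
    (#|[pred j | ~~ ((H j)%:Z %| n)%Z]| <= 2 * k ^ 2)%N &
    forall i, near_int (2%:R ^- k) (chi i (n - m))].

Lemma bohr_boundedW k H B B' : (B <= B')%N ->
  @bohr_bounded k H B -> @bohr_bounded k H B'.
Proof.
move=> BB h q chi m qk mk hchi; have [n [n1 n2 n3]] := h q chi m qk mk hchi.
by exists n; split => //; apply: leq_trans BB.
Qed.

Lemma bohr_stage k (H : 'I_(2 ^ k) -> nat) :
  (forall i j, i != j -> coprime (H i) (H j)) -> exists B, bohr_bounded H B.
Proof.
move=> cop.
have [y [ysum ydiv]] : exists y : 'I_(2 ^ k) -> int, \sum_i y i = 1 /\
    forall i j, i != j -> (H i %| y j)%Z.
  have [||i j _ _|y [ys yd]] := @coprime_bezout_sum _ H (enum 'I_(2 ^ k)).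
  - exact: enum_uniq.
  - by rewrite -size_eq0 size_enum_ord expn_eq0.
  - exact: cop.
  exists y; split; first by rewrite -ys big_enum.
  by move=> i j; apply: yd; rewrite mem_enum.
(* Only the Bezout coefficients and |m| <= k enter, so the bound is uniform in m and in the
   characters and is available when the tower is built. *)
exists (\sum_(j : 'I_(2 ^ k)) \sum_(i : 'I_(2 ^ k)) k * `|y i|)%N.
move=> q chi m qk mk hchi.
pose w i := m * y i.
(* With resolution 4 ^ k, the 2 ^ k errors of size 4 ^- k add up to 2 ^- k, while (4 ^ k) ^ q <= 2 ^
   (2 k ^ 2) controls the size of J. *)
have K0 : (0 < 4 ^ k)%N by rewrite expn_gt0.
have [J [cJ span]] := @maximal_dissociated_span _ _ (4 ^ k) chi K0 hchi w.
have {span} [c hc] := choice span.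
exists (\sum_j \sum_(i in J) c j i * w i); split.
- have absum (I : Type) (r : seq I) (P : pred I) (F : I -> int) :
    (`|(\sum_(i <- r | P i) F i)%R| <= \sum_(i <- r | P i) `|F i|)%N.
    elim/big_ind2: _ => // a1 b1 a2 b2 h1 h2.
    by apply: leq_trans (leq_add h1 h2); lia.
  apply: leq_trans (absum _ _ _ _) _; apply: leq_sum => j _.
  apply: leq_trans (absum _ _ _ _) _.
  rewrite [X in (_ <= X)%N](bigID (mem J)) /=; apply: leq_trans (leq_addr _ _).
  apply: leq_sum => i _; rewrite /w !abszM.
  have ci : (`|c j i| <= 1)%N by have := (hc j).1 i; lia.
  by rewrite -[X in (_ <= X)%N]mul1n leq_mul// leq_mul//.
- have cJ' : (#|J| <= 2 * k ^ 2)%N.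
    have : (2 ^ #|J| <= 2 ^ (2 * k ^ 2))%N.
      apply: leq_trans cJ _; rewrite -(expnM 2 2 k) -expnM leq_exp2l//.
      by rewrite -mulnA leq_mul2l /= -mulnn leq_mul2l qk orbT.
    by rewrite leq_exp2l.
  (* For l outside J every summand has i in J, so i <> l and H(l) divides y(i). *)
  apply: leq_trans _ cJ'; apply/subset_leq_card/fintype.subsetP => l.
  rewrite inE; apply: contraNT => lJ.
  apply: (big_ind (fun x : int => (H l %| x)%Z)) => [|a b|j _]; first exact: dvdz0.
    exact: rpredD.
  apply: (big_ind (fun x : int => (H l %| x)%Z)) => [|a b|i iJ]; first exact: dvdz0.
    exact: rpredD.
  rewrite /w dvdz_mull// dvdz_mull// ydiv//.
  by apply: contraNneq lJ => ->.
- move=> i.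
  (* The w(j) sum to m, so m - n is the sum of the individual errors. *)
  have -> : \sum_j \sum_(i0 in J) c j i0 * w i0 - m =
      - \sum_j (w j - \sum_(i0 in J) c j i0 * w i0).
    by rewrite sumrB opprB /w -big_distrr /= ysum mulr1.
  apply: (torus_hom_nearN (hchi i)).
  have := torus_hom_near_sum (hchi i) (fun j => (hc j).2 i).
  rewrite card_ord (_ : (2 ^ k)%:R / (4 ^ k)%:R = 2 ^- k)// .
  have -> : (4 ^ k = 2 ^ k * 2 ^ k)%N by rewrite -expnMn.
  rewrite natrM invfM mulrA mulfV ?mul1r ?natrX//.
Qed.

End BohrStage.

(** * The 2-adic odometer on bit sequences *)

Section Odometer.
Local Open Scope nat_scope.

Definition bitseqs := nat -> bool.

(** The residue modulo 2 ^ p of the 2-adic integer with binary digits y. *)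
Definition bval (p : nat) (y : bitseqs) : nat := \sum_(i < p) y i * 2 ^ i.

Lemma bvalS p y : bval p.+1 y = bval p y + y p * 2 ^ p.
Proof. by rewrite /bval big_ord_recr. Qed.

Lemma bval_lt p y : bval p y < 2 ^ p.
Proof.
elim: p => [|p IH]; first by rewrite /bval big_ord0.
rewrite bvalS expnS; case: (y p); lia.
Qed.

Lemma bval_mod q p y : q <= p -> bval p y %% 2 ^ q = bval q y.
Proof.
elim: p => [|p IH]; first by rewrite leqn0 => /eqP ->; rewrite modn_small// bval_lt.
rewrite leq_eqVlt => /predU1P[->|]; first by rewrite modn_small// bval_lt.
rewrite ltnS => qp; rewrite bvalS -(subnK qp) expnD mulnA addnC modnMDl subnK//.
exact: IH.
Qed.

Lemma bval_inj y z : (forall p, bval p y = bval p z) -> y = z.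
Proof.
move=> h; apply: funext => p; have := h p.+1; rewrite !bvalS (h p).
have := expn_gt0 2 p; case: (y p); case: (z p) => //=; lia.
Qed.

(** Addition of 1 with carry: digit i flips exactly when all lower digits are 1. In [odo_inv],
    subtraction with borrow, it flips when all are 0. *)
Definition odo (y : bitseqs) : bitseqs := fun i => y i (+) (bval i y == (2 ^ i).-1).

Definition odo_inv (y : bitseqs) : bitseqs := fun i => y i (+) (bval i y == 0).

Lemma bval_odo_nowrap p y : bval p (odo y) =
  if bval p y == (2 ^ p).-1 then 0 else (bval p y).+1.
Proof.
elim: p => [|p IH]; first by rewrite /bval !big_ord0.
rewrite !bvalS IH expnS /odo; have := bval_lt p y; have := expn_gt0 2 p.
case: (bval p y =P _) => h; case: (y p) => /=; case: eqP; lia.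
Qed.

Lemma bval_odo p y : bval p (odo y) = (bval p y).+1 %% 2 ^ p.
Proof.
rewrite bval_odo_nowrap; have := bval_lt p y; case: eqP => [->|h] lt.
  by rewrite prednK ?expn_gt0// modnn.
by rewrite modn_small//; lia.
Qed.

Lemma bval_odo_inv_nowrap p y : bval p (odo_inv y) =
  if bval p y == 0 then (2 ^ p).-1 else (bval p y).-1.
Proof.
elim: p => [|p IH]; first by rewrite /bval !big_ord0.
rewrite !bvalS IH expnS /odo_inv; have := bval_lt p y; have := expn_gt0 2 p.
case: (bval p y =P _) => h; case: (y p) => /=; case: eqP; lia.
Qed.

Lemma odoK : cancel odo odo_inv.
Proof.
move=> y; apply: bval_inj => p; rewrite bval_odo_inv_nowrap bval_odo_nowrap.
by have := bval_lt p y; case: (bval p y =P (2 ^ p).-1) => [->|].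
Qed.

Lemma odo_invK : cancel odo_inv odo.
Proof.
move=> y; apply: bval_inj => p; rewrite bval_odo_nowrap bval_odo_inv_nowrap.
have := bval_lt p y; have := expn_gt0 2 p.
case: (bval p y =P 0) => [->|h]; first by rewrite eqxx.
by case: ifP => [/eqP|]; lia.
Qed.

Lemma bval_iter_odo n p y : bval p (iter n odo y) = (bval p y + n) %% 2 ^ p.
Proof.
elim: n => [|n IH]; first by rewrite addn0 modn_small// bval_lt.
by rewrite iterS bval_odo IH addnS -[in LHS]addn1 modnDml addn1.
Qed.

End Odometer.

(** * Image measures *)

Section ImageMeasure.
Local Open Scope classical_set_scope.
Context d d' (T1 : measurableType d) (T2 : measurableType d') (R : realFieldType).
Variables (m : {measure set T1 -> \bar R}) (f : T1 -> T2).

(* [pushforward] with the measurability proof as an argument, so that the measure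
   structure can be inferred from the term. *)
Definition image_measure (mf : measurable_fun setT f) : set T2 -> \bar R :=
  pushforward m f.

Hypothesis mf : measurable_fun setT f.

Let measurable_preim A : measurable A -> measurable (f @^-1` A).
Proof. by move=> mA; rewrite -[X in measurable X]setTI; exact: mf. Qed.

Let image_measure0 : image_measure mf set0 = 0%E.
Proof. by rewrite /image_measure /pushforward preimage_set0 measure0. Qed.

Let image_measure_ge0 A : (0 <= image_measure mf A)%E.
Proof. by rewrite /image_measure /pushforward measure_ge0. Qed.

Let image_measure_sigma_additive : semi_sigma_additive (image_measure mf).
Proof.
move=> F mF tF mUF; rewrite /image_measure /pushforward preimage_bigcup.
apply: measure_semi_sigma_additive.
- by move=> n; exact: measurable_preim.
- apply/trivIsetP => /= i j _ _ ij; rewrite -preimage_setI.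
  by move/trivIsetP : tF => /(_ _ _ _ _ ij) ->//; rewrite preimage_set0.
- by rewrite -preimage_bigcup; exact: measurable_preim.
Qed.

HB.instance Definition _ := isMeasure.Build _ _ _ (image_measure mf)
  image_measure0 image_measure_ge0 image_measure_sigma_additive.

End ImageMeasure.

(** * Haar measure on the odometer space *)

Section OdometerSpace.
Local Open Scope classical_set_scope.
Variable R : realType.

Definition cyl (p a : nat) : set bitseqs := [set y | bval p y = a].

Definition cyls : set (set bitseqs) := [set C | exists p a, C = cyl p a].

Definition oseq := g_sigma_algebraType cyls.

Lemma measurable_cyl p a : measurable (cyl p a : set oseq).
Proof. by apply: sub_sigma_algebra; exists p, a. Qed.

Lemma cylI p q a b : (q <= p)%N ->
  cyl p a `&` cyl q b = if (a %% 2 ^ q == b)%N then cyl p a else set0 :> set bitseqs.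
Proof.
move=> qp; apply/seteqP; split => y; rewrite /cyl /=.
  by move=> [pa qb]; rewrite -qb -pa bval_mod// eqxx.
by case: eqP => //= h pa; rewrite -h -pa bval_mod.
Qed.

Lemma cyls_setI : setI_closed cyls.
Proof.
have c0 : cyls set0.
  exists 0%N, 1%N; apply/seteqP; split => // y; rewrite /cyl /=.
  by have := bval_lt 0 y; rewrite expn0; case: (bval 0 y).
have key p q a b : (q <= p)%N -> cyls (cyl p a `&` cyl q b).
  by move=> qp; rewrite cylI//; case: eqP => // _; exists p, a.
move=> _ _ [p [a ->]] [q [b ->]]; have [qp|pq] := leqP q p; first exact: key.
by rewrite setIC; apply: key; exact: ltnW.
Qed.

Lemma cyl0 : cyl 0 0 = setT.
Proof. by apply/seteqP; split => // y _; rewrite /cyl /= /bval big_ord0. Qed.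

(** The first binary digit of x becomes the lowest bit, so for x in [0, 1) [bval p] of the result is
    the bit reversal of floor(2 ^ p x). *)
Definition digits (x : R) : bitseqs := fun i => odd (Num.truncn (2 ^+ i.+1 * x)).

Lemma digits_cyl p a : (a < 2 ^ p)%N -> exists2 c : nat, (c < 2 ^ p)%N &
  forall x : R, 0 <= x < 1 ->
  (bval p (digits x) = a <-> c%:R <= 2 ^+ p * x < c.+1%:R).
Proof.
elim: p a => [|p IH] a ap.
  exists 0%N => // x x01; rewrite expr0 mul1r x01; split => // _.
  by rewrite /bval big_ord0; case: a ap.
have [|c cp hc] := IH (a %% 2 ^ p)%N; first by rewrite ltn_pmod// expn_gt0.
have [b aE] : exists b : bool, a = (a %% 2 ^ p + b * 2 ^ p)%N.
  exists (2 ^ p <= a)%N; case: leqP => h; last by rewrite modn_small// addn0.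
  rewrite -[in RHS](subnK h) modnDr modn_small ?mul1n ?subnK//.
  by rewrite expnS in ap; lia.
(* The top bit b of a is the last digit read from x, so it is appended at the bottom of c. *)
exists (c.*2 + b)%N => [|x x01]; first by rewrite expnS; case: (b); lia.
have x0 : 0 <= 2 ^+ p.+1 * x by rewrite mulr_ge0 ?exprn_ge0//; case/andP: x01.
have /andP[t1 t2] := truncn_itv x0.
have lt := bval_lt p (digits x).
have ltm : (a %% 2 ^ p < 2 ^ p)%N by rewrite ltn_pmod// expn_gt0.
have -> : bval p.+1 (digits x) = a <->
    bval p (digits x) = (a %% 2 ^ p)%N /\ digits x p = b.
  rewrite bvalS {1}aE; split => [|[-> ->//]].
  by case: (digits x p); case: (b) => /=; rewrite ?mul1n ?mul0n ?addn0; split; lia.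
rewrite (hc x x01) {1}/digits; move: t1 t2.
set t := Num.truncn _.
rewrite exprS -mulrA; set z := 2 ^+ p * x => t1 t2.
have nat2 (m n : nat) : (m%:R <= n%:R :> R) -> (m <= n)%N by rewrite ler_nat.
have -> : (c%:R <= z < c.+1%:R) = (c <= t./2 <= c)%N.
  apply/idP/idP => /andP[h1 h2].
    have : (c.*2 < t.+1)%N by rewrite -(ltr_nat R) -muln2 natrM; lra.
    have : (t < c.+1.*2)%N by rewrite -(ltr_nat R) -[in X in _ < X]muln2 natrM; lra.
    lia.
  have : (c.*2)%:R <= t%:R :> R by rewrite ler_nat; lia.
  have : t.+1%:R <= (c.+1.*2)%:R :> R by rewrite ler_nat; lia.
  rewrite -!muln2 !natrM; lra.
have -> : ((c.*2 + b)%:R <= 2 * z < (c.*2 + b).+1%:R) = (c.*2 + b <= t <= c.*2 + b)%N.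
  apply/idP/idP => /andP[h1 h2].
    have : (c.*2 + b < t.+1)%N by rewrite -(ltr_nat R); lra.
    have : (t < (c.*2 + b).+1)%N by rewrite -(ltr_nat R); lra.
    lia.
  have : (c.*2 + b)%:R <= t%:R :> R by rewrite ler_nat; lia.
  have : t.+1%:R <= (c.*2 + b).+1%:R :> R by rewrite ler_nat; lia.
  lra.
split; first by move=> [h <-]; lia.
by move=> h; split; first lia; case: (b) h; lia.
Qed.

Lemma digits_cyl_preimage p a : (a < 2 ^ p)%N -> exists2 c : nat, (c < 2 ^ p)%N &
  `[0, 1[%classic `&` digits @^-1` cyl p a =
  `[0, 1[%classic `&` `[c%:R / 2 ^+ p, c.+1%:R / 2 ^+ p[%classic :> set R.
Proof.
move=> /digits_cyl[c cp hc]; exists c => //; have p0 : 0 < 2 ^+ p :> R by rewrite exprn_gt0.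
apply/seteqP; split => x /=; rewrite !in_itv /= => -[x01].
  by move/(hc x x01); rewrite ler_pdivrMr// ltr_pdivlMr// ![x * _]mulrC.
by rewrite ler_pdivrMr// ltr_pdivlMr// ![x * _]mulrC => /(hc x x01).
Qed.

Let unit_itv : set (measurableTypeR R) := `[0, 1[%classic.

Let measurable_unit_itv : measurable unit_itv.
Proof. exact: measurable_itv. Qed.

(** Constant outside [0, 1), where the restricted Lebesgue measure has no mass, so that the map is
    measurable on the whole line. *)
Definition unit_digits (x : measurableTypeR R) : oseq :=
  if 0 <= x < 1 then digits x else fun=> false.

Lemma unit_digits_cyl p a : (a < 2 ^ p)%N -> exists2 c : nat, (c < 2 ^ p)%N &
  unit_digits @^-1` cyl p a `&` unit_itv = `[c%:R / 2 ^+ p, c.+1%:R / 2 ^+ p[%classic.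
Proof.
move=> /digits_cyl_preimage[c cp hc]; exists c => //.
transitivity (`[0, 1[%classic `&` digits @^-1` cyl p a : set R).
  apply/seteqP; split => x /=; rewrite /unit_itv /= in_itv /= /cyl /unit_digits /=.
    by move=> [+ x01]; rewrite x01.
  by move=> [x01 h]; rewrite x01.
rewrite hc setIidr// => x /=; rewrite !in_itv /= => /andP[h1 h2]; apply/andP; split.
  by apply: le_trans h1; rewrite divr_ge0// exprn_ge0.
apply: lt_le_trans h2 _; rewrite ler_pdivrMr ?exprn_gt0// mul1r.
by rewrite -natrX ler_nat.
Qed.

Lemma measurable_unit_digits : measurable_fun setT unit_digits.
Proof.
apply: (@measurability _ _ (measurableTypeR R) oseq _ _ cyls) => // _ [_ [p [a ->]] <-]; rewrite setTI.
rewrite -[X in measurable X](setUIDK _ unit_itv).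
have [ap|ap] := leqP (2 ^ p) a.
  rewrite (_ : _ @^-1` _ = set0) ?set0I ?set0D ?setU0//.
  apply/seteqP; split => // x; rewrite /cyl /= => h.
  by have := bval_lt p (unit_digits x); rewrite h ltnNge ap.
apply: measurableU.
  by have [c _ ->] := unit_digits_cyl ap; exact: measurable_itv.
rewrite (_ : _ `\` _ = if bval p (fun=> false) == a then ~` unit_itv else set0); last first.
  have h x : ~ unit_itv x -> unit_digits x = fun=> false.
    by rewrite /unit_itv /= in_itv /= /unit_digits; case: ifP.
  apply/seteqP; split => x; rewrite /cyl /=.
    by move=> [+ nx]; rewrite h// => ->; rewrite eqxx.
  by case: eqP => // hb nx; split => //; rewrite h.
by case: ifP => // _; exact: measurableC.
Qed.

(** Haar measure of the 2-adic integers, obtained from Lebesgue measure by the digit map so that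
    countable additivity is inherited. *)
Definition odo_measure : set oseq -> \bar R :=
  image_measure (mrestr lebesgue_measure measurable_unit_itv) measurable_unit_digits.

HB.instance Definition _ := Measure.on odo_measure.

Let odo_measureT : odo_measure setT = 1%E.
Proof.
transitivity (lebesgue_measure unit_itv).
  by rewrite -[in RHS](setTI unit_itv).
by rewrite lebesgue_measure_itv /= lte_fin ltr01 oppr0 adde0.
Qed.

HB.instance Definition _ :=
  Measure_isProbability.Build _ _ _ odo_measure odo_measureT.

Lemma odo_measure_cyl p a : (a < 2 ^ p)%N -> odo_measure (cyl p a) = (2 ^- p)%:E.
Proof.
move=> /unit_digits_cyl[c _ hc]; rewrite /odo_measure /image_measure /pushforward /mrestr.
transitivity (lebesgue_measure (`[c%:R / 2 ^+ p, c.+1%:R / 2 ^+ p[%classic : set R)).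
  by rewrite -hc.
rewrite lebesgue_measure_itv /= lte_fin.
rewrite ltr_pM2r ?invr_gt0 ?exprn_gt0// ltr_nat ltnSn -EFinB -mulrBl.
by rewrite -natrB// subSnn mul1r.
Qed.

End OdometerSpace.

(** * Invariance and ergodicity of the odometer *)

Section OdometerErgodic.
Local Open Scope classical_set_scope.
Variable R : realType.
Local Notation nu := (odo_measure R).

(** Since p bits of the image are determined by p bits of the argument, the preimage of a cylinder
    is a countable union of cylinders. *)
Lemma measurable_fun_bval (g : oseq -> oseq) (h : nat -> nat -> nat) :
  (forall p y, bval p (g y) = h p (bval p y)) -> measurable_fun setT g.
Proof.
move=> gh; apply: (@measurability _ _ oseq oseq _ _ cyls) => // _ [_ [p [a ->]] <-].
rewrite setTI (_ : _ @^-1` _ = \bigcup_(b in [set b | h p b = a]) cyl p b); last first.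
  apply/seteqP; split => y; rewrite /cyl /=; first by rewrite gh => hy; exists (bval p y).
  by move=> [b /= hb yb]; rewrite gh yb.
by apply: bigcup_measurable => b _; exact: measurable_cyl.
Qed.

Lemma measurable_odo : measurable_fun setT (odo : oseq -> oseq).
Proof. by apply: (@measurable_fun_bval _ (fun p v => v.+1 %% 2 ^ p)%N); exact: bval_odo. Qed.

Lemma measurable_odo_inv : measurable_fun setT (odo_inv : oseq -> oseq).
Proof.
apply: (@measurable_fun_bval _ (fun p v => if v == 0%N then (2 ^ p).-1 else v.-1)).
exact: bval_odo_inv_nowrap.
Qed.

Lemma odo_preimage_measurable (A : set oseq) :
  measurable A -> measurable (odo @^-1` A : set oseq).
Proof. by move=> mA; rewrite -[X in measurable X]setTI; exact: measurable_odo. Qed.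

Lemma cyl_empty p a : (2 ^ p <= a)%N -> cyl p a = set0.
Proof.
move=> pa; apply/seteqP; split => // y; rewrite /cyl /= => h.
by have := bval_lt p y; rewrite h ltnNge pa.
Qed.

Lemma odo_preimage_cylS p a : (a.+1 < 2 ^ p)%N -> odo @^-1` cyl p a.+1 = cyl p a.
Proof.
move=> ap; apply/seteqP; split => y; rewrite /cyl /= bval_odo_nowrap.
  by case: eqP => // _ [].
by move=> ->; case: eqP => //; lia.
Qed.

Lemma odo_preimage_cyl0 p : odo @^-1` cyl p 0 = cyl p (2 ^ p).-1.
Proof.
by apply/seteqP; split => y; rewrite /cyl /= bval_odo_nowrap; case: eqP.
Qed.

(** The odometer permutes the cylinders of a given length, which have equal measure; the rest is a
    Dynkin argument. *)
Lemma odo_preserving (A : set oseq) : measurable A -> nu (odo @^-1` A) = nu A.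
Proof.
move: A; apply: (@dynkin_induction _ oseq cyls) => //.
- exact: cyls_setI.
- move=> _ [p [a ->]]; have [ap|ap] := leqP (2 ^ p) a.
    by rewrite cyl_empty// preimage_set0.
  case: a ap => [|a] ap.
    rewrite odo_preimage_cyl0 !odo_measure_cyl// prednK// expn_gt0//.
  rewrite odo_preimage_cylS// !odo_measure_cyl//; lia.
- move=> S mS hS; have mS' := odo_preimage_measurable mS.
  by rewrite preimage_setC (probability_setC nu mS) (probability_setC nu mS'); congr (_ - _)%E; exact: hS.
- move=> F mF tF hF; rewrite preimage_bigcup !measure_bigcup//.
  + by apply: eq_eseriesr => i _; exact: hF.
  + by move=> n _; exact: odo_preimage_measurable.
  + apply/trivIsetP => /= i j _ _ ij; rewrite -preimage_setI.
    by move/trivIsetP : tF => /(_ _ _ _ _ ij) ->//; rewrite preimage_set0.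
Qed.

Section Invariant.
Variable E : set oseq.
Hypotheses (mE : measurable E) (oE : odo @^-1` E = E).

(** Taking preimages fixes E and lowers the cylinder index by one. *)
Let odo_cyl_const p a : (a < 2 ^ p)%N -> nu (E `&` cyl p a) = nu (E `&` cyl p 0).
Proof.
elim: a => // a IH ap; rewrite -IH; last exact: ltnW.
rewrite -[in LHS]odo_preserving; last by apply: measurableI => //; exact: measurable_cyl.
by rewrite preimage_setI oE odo_preimage_cylS.
Qed.

Let odo_cyl_split p : cyl p 0 = cyl p.+1 0 `|` cyl p.+1 (2 ^ p).
Proof.
apply/seteqP; split => y; rewrite /cyl /= !bvalS; have := bval_lt p y.
  by case: (y p) => /= h ->; [right|left]; rewrite ?mul1n.
by case: (y p) => /= h []; lia.
Qed.

(** A cylinder splits into two of the next length, which E meets in equal mass, so that mass halves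
    at each step. *)
Let odo_cyl_inv p a : (a < 2 ^ p)%N -> nu (E `&` cyl p a) = (nu E * (2 ^- p)%:E)%E.
Proof.
move=> /odo_cyl_const ->; elim: p => [|p IH].
  by rewrite cyl0 setIT expr0 invr1 mule1.
have p0 : (0 < 2 ^ p)%N by rewrite expn_gt0.
have mEc q b : measurable (E `&` cyl q b) by apply: measurableI => //; exact: measurable_cyl.
have split : nu (E `&` cyl p 0) = (nu (E `&` cyl p.+1 0) + nu (E `&` cyl p.+1 (2 ^ p)))%E.
  rewrite odo_cyl_split setIUr measureU//.
  rewrite setIACA (_ : cyl _ _ `&` cyl _ _ = set0) ?setI0//.
  by apply/seteqP; split => // y; rewrite /cyl /= => -[-> h]; rewrite -h in p0.
rewrite split odo_cyl_const in IH; last by rewrite expnS; lia.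
move: IH; have m0 := mEc p.+1 0%N.
rewrite -(fineK (fin_num_measure nu _ m0)) -(fineK (fin_num_measure nu _ mE)).
rewrite -EFinD -!EFinM => -[h]; congr (_%:E); rewrite exprS invfM; lra.
Qed.

(* E is independent of every cylinder, hence of itself. *)
Lemma odo_ergodic : nu E = 0%E \/ nu E = 1%E.
Proof.
have : nu (E `&` E) = (nu E * nu E)%E.
  apply: (@dynkin_induction _ oseq cyls (fun A => nu (E `&` A) = (nu E * nu A)%E)) => //.
  - exact: cyls_setI.
  - by rewrite setIT probability_setT mule1.
  - move=> _ [p [a ->]]; have [ap|ap] := leqP (2 ^ p) a.
      by rewrite cyl_empty// setI0 measure0 mule0.
    by rewrite odo_cyl_inv// odo_measure_cyl.
  - move=> S mS hS; rewrite -setDE.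
    have -> : nu (E `\` S) = (nu E - nu (E `&` S))%E.
      by rewrite measureD// (le_lt_trans (probability_le1 _ _)) ?ltry.
    have -> : nu (~` S) = (1 - nu S)%E by exact: (probability_setC nu mS).
    rewrite hS.
    have fE := fin_num_measure nu _ mE; have fS := fin_num_measure nu _ mS.
    rewrite -(fineK fE) -(fineK fS) -!EFinM -!EFinB -?EFinM; congr (_%:E).
    by rewrite mulrBr mulr1.
  - move=> F mF tF hF; rewrite setI_bigcupr !measure_bigcup//.
    + rewrite -(fineK (fin_num_measure nu _ mE)) -nneseriesZl//.
      by apply: eq_eseriesr => i _; rewrite fineK ?fin_num_measure//; exact: hF.
    + by move=> n _; apply: measurableI.
    + exact: trivIset_setIl.
rewrite setIid -(fineK (fin_num_measure nu _ mE)) -EFinM => -[] h.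
have : fine (nu E) * (fine (nu E) - 1) = 0 by rewrite mulrBr mulr1 -h subrr.
move/eqP; rewrite mulf_eq0 subr_eq0 => /orP[]/eqP ->; by [left|right].
Qed.

End Invariant.
End OdometerErgodic.

(** * Stages of the construction and the roof function *)

Section RoofFunction.
Local Open Scope nat_scope.
Variable R : realType.

(** Bound for the spacers added over one point at stage k; [roof_bound] accumulates them on top of
    the initial roof 1. *)
Definition spacer_bound k := 2 ^ k * (2 ^ k)`! + 1.
Definition roof_bound k := 1 + \sum_(j < k) spacer_bound j.

(* Heights congruent to 1 modulo (2^k)! are pairwise coprime for j < 2^k, since a
   common prime factor would divide both a difference of indices and (2^k)!. *)
Definition block_height (k h j : nat) := (h %/ (2 ^ k)`! + 1 + j) * (2 ^ k)`! + 1.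

Lemma block_height_gt k h j : h < block_height k h j.
Proof.
rewrite /block_height {1}(divn_eq h (2 ^ k)`!).
have := ltn_pmod h (fact_gt0 (2 ^ k)); rewrite !mulnDl; lia.
Qed.

Lemma block_height_sub_le k h j : j < 2 ^ k ->
  block_height k h j - h <= spacer_bound k.
Proof.
move=> jk; rewrite /block_height /spacer_bound {2}(divn_eq h (2 ^ k)`!).
have : j.+1 * (2 ^ k)`! <= 2 ^ k * (2 ^ k)`! by rewrite leq_mul2r jk orbT.
rewrite !mulnDl mulSn; lia.
Qed.

Lemma block_height_coprime k h i j : i < 2 ^ k -> j < 2 ^ k -> i != j ->
  coprime (block_height k h i) (block_height k h j).
Proof.
wlog ij : i j / i < j => [wlg|] ik jk.
  rewrite neq_ltn => /orP[] ij; [|rewrite coprime_sym]; apply: wlg => //.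
    by rewrite neq_ltn ij.
  by rewrite neq_ltn ij.
move=> _; set M := (2 ^ k)`!.
have copM : coprime (block_height k h i) M.
  by rewrite /block_height -/M coprime_sym /coprime gcdnMDl gcdn1.
have -> : block_height k h j = (j - i) * M + block_height k h i.
  by rewrite /block_height -/M mulnBl; have := leq_mul (ltnW ij) (leqnn M); lia.
rewrite /coprime gcdnDr -/(coprime _ _) coprimeMr copM andbT.
by apply: coprime_dvdr copM; rewrite dvdn_fact// subn_gt0 ij; lia.
Qed.

(** Existence of a bound to be picked by [xget] is supplied later by [stage_bounded]. The product is
    added so that it is itself an admissible time, which makes the set of times infinite. *)
Definition bohr_height_bound (k : nat) (H : 'I_(2 ^ k) -> nat) : nat :=
  xget 0 [set B | bohr_bounded R H B]%classic + \prod_(j < 2 ^ k) H j.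

(* [stage_roof a] is the height of the tower over the points with low bits [a]; the
   value at the all-ones string is provisional, since the next stage adds spacers there. *)
Record stage := Stage { stage_bits : nat; stage_roof : nat -> nat }.

Section Step.
Variables (k : nat) (s : stage).
Local Notation p := (stage_bits s).
Local Notation F := (stage_roof s).

Definition stage_height := \sum_(a < 2 ^ p) F a.
Definition stage_block j := block_height k stage_height j.
Definition stage_bound := bohr_height_bound (fun j : 'I_(2 ^ k) => stage_block j).
(* The first two terms make the last [stage_bound] columns of a chunk negligible, the
   third makes the mass above height [i] at most [2 ^- i]. *)
Definition stage_columns := k + stage_bound + roof_bound k.+2.
(** The k new top bits number the chunk; the [stage_columns] bits below them number the column
    within it. *)
Definition stage_chunk a := a %/ 2 ^ (p + stage_columns).

(** A column is a run of 2 ^ p base points ending at an all-ones string; the spacers over that end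
    raise its total from [stage_height] to the [stage_block] of its chunk. *)
Definition next_stage := Stage (p + stage_columns + k) (fun a =>
  F (a %% 2 ^ p) + (a %% 2 ^ p == (2 ^ p).-1) * (stage_block (stage_chunk a) - stage_height)).
End Step.

Fixpoint stages k : stage :=
  if k is k'.+1 then next_stage k' (stages k') else Stage (roof_bound 1) (fun=> 1).

Local Notation p k := (stage_bits (stages k)).
Local Notation F k := (stage_roof (stages k)).
Local Notation h k := (stage_height (stages k)).
Local Notation H k := (stage_block k (stages k)).
Local Notation l k := (stage_columns k (stages k)).

Lemma stages_bitsS k : p k.+1 = p k + l k + k. Proof. by []. Qed.

Lemma stage_columns_ge k : k + stage_bound k (stages k) <= l k.
Proof. exact: leq_addr. Qed.

Lemma stage_bound_ge k : \prod_(j < 2 ^ k) H k j <= stage_bound k (stages k).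
Proof. exact: leq_addl. Qed.

(** The initial bit count and the third term of [stage_columns] are chosen for this inequality, on
    which [roof_gt_all_ones] rests. *)
Lemma roof_bound_bits k : roof_bound k.+1 <= p k.
Proof. by case: k => [//|k]; rewrite stages_bitsS /stage_columns; lia. Qed.

Lemma bits_gt k : k < p k.
Proof.
apply: leq_trans (roof_bound_bits k); rewrite /roof_bound.
have : \sum_(j < k.+1) 1 <= \sum_(j < k.+1) spacer_bound j.
  by apply: leq_sum => j _; rewrite /spacer_bound addn1.
by rewrite sum_nat_const card_ord; lia.
Qed.

Lemma leq_bits k m : k <= m -> p k <= p m.
Proof.
elim: m => [|m IH]; first by rewrite leqn0 => /eqP ->.
rewrite leq_eqVlt => /predU1P[->//|]; rewrite ltnS => /IH h; rewrite stages_bitsS; lia.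
Qed.

Lemma stages_roofS k a : F k.+1 a = F k (a %% 2 ^ p k) +
  (a %% 2 ^ p k == (2 ^ p k).-1) * (H k (a %/ 2 ^ (p k + l k)) - h k).
Proof. by []. Qed.

Lemma roof_gt0 k a : 0 < F k a.
Proof. by elim: k a => // k IH a; rewrite stages_roofS addn_gt0 IH. Qed.

Lemma roof_le k a : a < 2 ^ p k -> F k a <= roof_bound k.
Proof.
elim: k a => [|k IH] a ap; first by rewrite /roof_bound big_ord0.
rewrite stages_roofS /roof_bound big_ord_recr /= addnA; apply: leq_add.
  by apply: IH; rewrite ltn_pmod// expn_gt0.
case: eqP => // _; rewrite mul1n; apply: block_height_sub_le.
by rewrite ltn_divLR ?expn_gt0// -expnD addnC.
Qed.

Definition all_ones q (y : bitseqs) := bval q y == (2 ^ q).-1.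

Lemma all_onesW q r y : q <= r -> all_ones r y -> all_ones q y.
Proof.
move=> qr /eqP hr; rewrite /all_ones -(bval_mod y qr) hr.
rewrite -(subnK qr) expnD; have := expn_gt0 2 q; have := expn_gt0 2 (r - q).
move=> /= a0 b0; apply/eqP.
rewrite (_ : (_ * _).-1 = (2 ^ (r - q)).-1 * 2 ^ q + (2 ^ q).-1); last first.
  by case: (2 ^ (r - q)) a0 => // c _; rewrite mulSn /=; lia.
by rewrite modnMDl modn_small//; lia.
Qed.

(** The roof is final at any stage whose low bits are not all ones. Only the constant sequence of
    ones has no such stage; the default stage 0 gives it roof 1. *)
Definition roof (y : bitseqs) : nat :=
  let k := xget 0 [set k | ~~ all_ones (p k) y]%classic in F k (bval (p k) y).

(** Spacers are added only over all-ones strings, and a string that is not all ones stays so when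
    more bits are read. *)
Lemma roof_stage_mono k m y : ~~ all_ones (p k) y -> k <= m ->
  F m (bval (p m) y) = F k (bval (p k) y).
Proof.
move=> ky; elim: m => [|m IH]; first by rewrite leqn0 => /eqP ->.
rewrite leq_eqVlt => /predU1P[->//|]; rewrite ltnS => km.
rewrite stages_roofS bval_mod; last exact: leq_bits.
have my : ~~ all_ones (p m) y by apply: contra ky; apply: all_onesW; exact: leq_bits.
by rewrite -/(all_ones (p m) y) (negbTE my) addn0 IH.
Qed.

Lemma roofE k y : ~~ all_ones (p k) y -> roof y = F k (bval (p k) y).
Proof.
move=> ky; rewrite /roof /=; case: xgetP => [m _ my|/(_ k)]; last by move/(_ ky).
have [km|mk] := leqP k m; first exact: roof_stage_mono.
by apply/esym/roof_stage_mono => //; exact: ltnW.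
Qed.

Lemma roof_all_ones y : (forall k, all_ones (p k) y) -> roof y = 1.
Proof.
move=> hy; rewrite /roof /=; case: xgetP => [m _|]; first by rewrite /= hy.
by move=> _.
Qed.

Lemma roof_ge1 y : 0 < roof y.
Proof. exact: roof_gt0. Qed.

(** If [roof_bound k] <= i < [roof_bound k.+1], the roof exceeds i only where the low [p k] bits are
    all ones, and [p k] is at least [roof_bound k.+1]. *)
Lemma roof_gt_all_ones i y : i < roof y -> all_ones i y.
Proof.
have main k : i < roof_bound k -> i < roof y -> all_ones i y.
  elim: k => [|k IH] ik iy.
    have -> : i = 0 by move: ik; rewrite /roof_bound big_ord0; lia.
    by rewrite /all_ones /bval big_ord0.
  have [ik'|ki] := ltnP i (roof_bound k); first exact: IH.
  have [h|h] := boolP (all_ones (p k) y).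
    by apply: all_onesW h; have := roof_bound_bits k; lia.
  by have := roof_le (bval_lt (p k) y); rewrite -(roofE h); lia.
apply: (main i.+1); have := bits_gt i; rewrite /roof_bound.
have : \sum_(j < i.+1) 1 <= \sum_(j < i.+1) spacer_bound j.
  by apply: leq_sum => j _; rewrite /spacer_bound addn1.
by rewrite sum_nat_const card_ord; lia.
Qed.

Lemma stage_bounded k (hk : forall i j, i < 2 ^ k -> j < 2 ^ k -> i != j ->
    coprime (H k i) (H k j)) :
  bohr_bounded R (fun j : 'I_(2 ^ k) => H k j) (stage_bound k (stages k)).
Proof.
rewrite /stage_bound /bohr_height_bound; apply: bohr_boundedW (leq_addr _ _) _.
case: xgetP => [B _ //|].
have [|B hB /(_ B)//] := @bohr_stage R k (fun j : 'I_(2 ^ k) => H k j).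
by move=> i j ij; exact: hk.
Qed.

End RoofFunction.

(** * Birkhoff sums of the roof along columns *)

Section BirkhoffSums.
Local Open Scope nat_scope.
#[local] Opaque stages stage_columns.
Variable R : realType.
Local Notation p k := (stage_bits (stages R k)).
Local Notation F k := (stage_roof (stages R k)).
Local Notation h k := (stage_height (stages R k)).
Local Notation H k := (stage_block k (stages R k)).
Local Notation l k := (stage_columns R k (stages R k)).
Local Notation roof := (roof R).

Lemma sum_periodic (g : nat -> nat) N a : (forall b, g (b + N) = g b) ->
  \sum_(t < N) g (a + t) = \sum_(t < N) g t.
Proof.
move=> gN; elim: a => [|a IH]; first by apply: eq_bigr.
rewrite -IH; apply: (@addnI (g a)).
have -> : g a + \sum_(t < N) g (a.+1 + t) = \sum_(t < N.+1) g (a + t).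
  by rewrite big_ord_recl addn0; congr (_ + _); apply: eq_bigr => t _; rewrite addSnnS.
by rewrite big_ord_recr /= gN addnC.
Qed.

(** The time the tower map takes from the bottom over y to the bottom over [iter n odo y]. *)
Definition roof_sum n y := \sum_(t < n) roof (iter t odo y).

Lemma roof_sumD m n y : roof_sum (m + n) y = roof_sum m y + roof_sum n (iter m odo y).
Proof.
rewrite /roof_sum big_split_ord /=; congr (_ + _).
by apply: eq_bigr => t _; rewrite addnC iterD.
Qed.

Lemma bval_iter_odo_small n q y : bval q y + n < 2 ^ q ->
  bval q (iter n odo y) = bval q y + n.
Proof. by move=> lt; rewrite bval_iter_odo modn_small. Qed.

(* One period of the low bits meets every base value once, and crosses exactly one spacer. *)
Lemma roof_sum_window k y : bval (p k.+1) y + 2 ^ p k < 2 ^ p k.+1 ->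
  roof_sum (2 ^ p k) y = H k (bval (p k.+1) y %/ 2 ^ (p k + l k)).
Proof.
set a := bval _ y; set N := 2 ^ p k => aN.
have N0 : 0 < N by rewrite expn_gt0.
have -> : roof_sum N y = \sum_(t < N) (F k ((a + t) %% N) +
    ((a + t) %% N == N.-1) * (H k (a %/ 2 ^ (p k + l k)) - h k)).
  apply: eq_bigr => t _; have tN := ltn_ord t.
  have at_ : bval (p k.+1) (iter t odo y) = a + t.
    by apply: bval_iter_odo_small; rewrite -/a; lia.
  (* Here a + t <= 2 ^ p k.+1 - 2, so stage [k.+1] already gives the final roof. *)
  rewrite (@roofE _ k.+1); last by rewrite /all_ones at_; apply/eqP; lia.
  rewrite at_ stages_roofS -/N; congr (_ + _); case: eqP => // e.
  (* The spacer met ends the column containing a, so it belongs to the chunk of a. *)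
  rewrite expnD !divnMA; congr (_ * (H k (_ %/ _) - _)).
  have aq : a = (a + t) %/ N * N + (N.-1 - t) by have := divn_eq (a + t) N; rewrite e; lia.
  by rewrite -/N [in RHS]aq divnMDl// (@divn_small (N.-1 - t)) ?addn0//; lia.
rewrite big_split /= -big_distrl /=.
rewrite (@sum_periodic (fun b => F k (b %% N))); last by move=> b; rewrite modnDr.
rewrite (@sum_periodic (fun b => (b %% N == N.-1) : nat)); last by move=> b; rewrite modnDr.
have -> : \sum_(t < N) F k (t %% N) = h k.
  by apply: eq_bigr => t _; rewrite modn_small.
have -> : \sum_(t < N) (t %% N == N.-1) = 1.
  have lt : N.-1 < N by rewrite prednK.
  rewrite (bigD1 (Ordinal lt)) //= modn_small// eqxx big1 // => t.
  by rewrite -val_eqE /= modn_small// => /negbTE ->.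
by rewrite mul1n subnKC// ltnW// block_height_gt.
Qed.

Lemma expn_stages_bitsS k : 2 ^ p k.+1 = 2 ^ k * 2 ^ l k * 2 ^ p k.
Proof.
rewrite stages_bitsS (expnD _ (p k + l k)) (expnD _ (p k)).
by rewrite mulnC (mulnC (2 ^ p k)) mulnA.
Qed.

(** The hypothesis keeps all q passes inside one chunk, where each pass costs the same height. *)
Lemma roof_sum_block k q y :
  (bval (p k.+1) y %/ 2 ^ p k) %% 2 ^ l k + q < 2 ^ l k ->
  roof_sum (q * 2 ^ p k) y = q * H k (bval (p k.+1) y %/ 2 ^ (p k + l k)).
Proof.
set a := bval _ y; set N := 2 ^ p k; set L := 2 ^ l k.
have N0 : 0 < N by rewrite expn_gt0.
have L0 : 0 < L by rewrite expn_gt0.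
have pS : 2 ^ p k.+1 = 2 ^ k * L * N := expn_stages_bitsS k.
have aK : a %/ (N * L) < 2 ^ k.
  rewrite ltn_divLR ?muln_gt0 ?N0// (mulnC N) mulnA -pS /a; exact: bval_lt.
elim: q => [|q IH] hq; first by rewrite /roof_sum big_ord0.
have cq : a %/ N = a %/ (N * L) * L + (a %/ N) %% L by rewrite divnMA -divn_eq.
have aN : a = a %/ N * N + a %% N := divn_eq a N.
(* The column index stays below the end of its chunk, and the chunk index below 2 ^ k, so no carry
   leaves the low [p k.+1] bits. *)
have aqN : a + q * N + N < 2 ^ p k.+1.
  rewrite pS; have : (a %/ N + q + 2) * N <= 2 ^ k * L * N.
    rewrite leq_mul2r; apply/orP; right; rewrite cq.
    have : (a %/ (N * L)).+1 * L <= 2 ^ k * L by rewrite leq_mul2r aK orbT.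
    rewrite mulSn; lia.
  have := ltn_pmod a N0; rewrite !mulnDl; lia.
have by' : bval (p k.+1) (iter (q * N) odo y) = a + q * N.
  by apply: bval_iter_odo_small; rewrite -/a; lia.
rewrite mulSn addnC roof_sumD IH; last lia.
rewrite roof_sum_window by'; last exact: aqN.
rewrite expnD -/N -/L (_ : (a + q * N) %/ (N * L) = a %/ (N * L)); last first.
  rewrite !divnMA addnC divnMDl// {1}(divn_eq (a %/ N) L) addnCA divnMDl//.
  by rewrite (@divn_small (q + _)) ?addn0//; lia.
by rewrite mulSn addnC.
Qed.

Lemma roof_iter_odo k q y : ~~ all_ones (p k) y ->
  roof (iter (q * 2 ^ p k) odo y) = roof y.
Proof.
move=> hy; have e : bval (p k) (iter (q * 2 ^ p k) odo y) = bval (p k) y.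
  by rewrite bval_iter_odo addnC modnMDl modn_small// bval_lt.
by rewrite !(@roofE _ k) /all_ones ?e.
Qed.
End BirkhoffSums.

(** * The tower map and its measure *)

Section Tower.
Local Open Scope classical_set_scope.
Variable R : realType.
Local Notation p k := (stage_bits (stages R k)).
Local Notation F k := (stage_roof (stages R k)).
Local Notation roof := (roof R).
Local Notation nu := (odo_measure R).
#[local] Opaque stages stage_columns.

Lemma measurable_all_ones q : measurable [set y : oseq | all_ones q y].
Proof.
rewrite (_ : [set _ | _] = cyl q (2 ^ q).-1); first exact: measurable_cyl.
by apply/seteqP; split => y /eqP.
Qed.

Lemma measurable_roof (P : set nat) : measurable (roof @^-1` P : set oseq).
Proof.
have -> : roof @^-1` P =
    \bigcup_k (\bigcup_(a in F k @^-1` P) cyl (p k) a `\` [set y | all_ones (p k) y])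
    `|` (if pselect (P 1%N) then \bigcap_k [set y | all_ones (p k) y] else set0).
  apply/seteqP; split => y /=.
    have [hy|] := pselect (forall k, all_ones (p k) y).
      by rewrite (roof_all_ones hy) => P1; right; case: pselect => // _ k _; exact: hy.
    move=> /existsNP[k /negP hk]; rewrite (roofE hk) => Py; left; exists k => //; split => //.
      by exists (bval (p k) y).
    exact/negP.
  case=> [[k _ [[a Pa ya] /negP hk]]|].
    by rewrite (roofE hk); move: ya; rewrite /cyl /= => ->.
  case: pselect => // P1 hy; rewrite roof_all_ones// => k; exact: hy.
apply: measurableU.
  apply: bigcup_measurable => k _; apply: measurableD; last exact: measurable_all_ones.
  by apply: bigcup_measurable => a _; exact: measurable_cyl.
case: pselect => h; last exact: (@measurable0 _ oseq).
exact: (@bigcapT_measurable _ oseq _ (fun k => measurable_all_ones (p k))).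
Qed.

Local Notation tower := (oseq * nat)%type.

Definition level (A : set tower) (i : nat) : set oseq := (fun y => (y, i)) @^-1` A.

Lemma measurable_level A i : measurable A -> measurable (level A i).
Proof.
by move=> mA; rewrite -[X in measurable X]setTI; exact: (pair2_measurable i).
Qed.

Lemma levels_measurable A : (forall i, measurable (level A i)) -> measurable A.
Proof.
move=> mA; rewrite (_ : A = \bigcup_i (level A i `*` [set i])); last first.
  apply/seteqP; split => -[y i]; first by move=> h; exists i.
  by move=> [j _ [/= h ->]].
by apply: bigcup_measurable => i _; exact: measurableX.
Qed.

(* Points above the roof are fixed; [tower_measure] does not charge them. *)
Definition tower_map (x : tower) : tower :=
  if (x.2.+1 < roof x.1)%N then (x.1, x.2.+1)
  else if x.2.+1 == roof x.1 then (odo x.1, 0%N) else x.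

Definition tower_inv (x : tower) : tower :=
  if (x.2 < roof x.1)%N then
    if x.2 is i.+1 then (x.1, i) else (odo_inv x.1, (roof (odo_inv x.1)).-1)
  else x.

Lemma tower_mapK : cancel tower_map tower_inv.
Proof.
move=> [y i]; rewrite /tower_map /=; case: ltnP => h1; first by rewrite /tower_inv /= h1.
case: eqP => h2; first by rewrite /tower_inv /= (roof_ge1 R) odoK -h2.
by rewrite /tower_inv /=; case: ltnP => //; lia.
Qed.

Lemma tower_invK : cancel tower_inv tower_map.
Proof.
move=> [y i]; rewrite /tower_inv /=; case: ltnP => h1.
  case: i h1 => [|i] h1; rewrite /tower_map /=; last by rewrite h1.
  by have := roof_ge1 R (odo_inv y); case: (roof (odo_inv y)) => //= n _; rewrite ltnn eqxx odo_invK.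
by rewrite /tower_map /=; case: ltnP => //; [lia|case: eqP => //; lia].
Qed.

Lemma measurable_tower_map : measurable_fun setT tower_map.
Proof.
move=> _ A mA; rewrite setTI; apply: levels_measurable => i.
have -> : level (tower_map @^-1` A) i =
  (roof @^-1` [set n | (i.+1 < n)%N] `&` level A i.+1) `|`
  (roof @^-1` [set i.+1] `&` odo @^-1` level A 0) `|`
  (roof @^-1` [set n | (n <= i)%N] `&` level A i).
  apply/seteqP; split => y; rewrite /level /tower_map /=.
    case: ltnP => h1; first by left; left.
    by case: eqP => h2; [left; right|right; split => //; lia].
  case=> [[]|].
  - by move=> [-> ?].
  - by move=> [-> ?]; rewrite ltnn eqxx.
  - by move=> [h ?]; rewrite ltnNge ltnW ?ltnS// gtn_eqF// ltnS.
by apply: measurableU; [apply: measurableU|]; apply: measurableI;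
  do ?[exact: measurable_roof|exact: measurable_level|apply: odo_preimage_measurable].
Qed.

Lemma measurable_tower_inv : measurable_fun setT tower_inv.
Proof.
have mo (B : set oseq) : measurable B -> measurable (odo_inv @^-1` B : set oseq).
  by move=> mB; rewrite -[X in measurable X]setTI; exact: measurable_odo_inv.
move=> _ A mA; rewrite setTI; apply: levels_measurable => i.
have -> : level (tower_inv @^-1` A) i =
  (roof @^-1` [set n | (n <= i)%N] `&` level A i) `|`
  (roof @^-1` [set n | (i < n)%N] `&`
   if i is j.+1 then level A j
   else \bigcup_m (odo_inv @^-1` (roof @^-1` [set m.+1] `&` level A m))).
  apply/seteqP; split => y; rewrite /level /tower_inv /=.
    case: ltnP => h1; last by left.
    case: i h1 => [|i] h1 h; right; split => //.
    exists (roof (odo_inv y)).-1 => //; split => //=; by rewrite prednK// (roof_ge1 R).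
  case=> [[h1 h2]|[h1]]; first by rewrite ltnNge h1.
  rewrite h1; case: i h1 => [|i] h1 //.
  by move=> [m _ [/= -> ]].
apply: measurableU; apply: measurableI;
  do ?[exact: measurable_roof|exact: measurable_level].
case: i => [|i]; last exact: measurable_level.
apply: bigcup_measurable => m _; apply: mo; apply: measurableI;
  do ?[exact: measurable_roof|exact: measurable_level].
Qed.

Lemma measurable_roof_gt i : measurable (roof @^-1` [set n | (i < n)%N] : set oseq).
Proof. exact: measurable_roof. Qed.

(** The map behind [image_measure] is y |-> (y, i), read off from [pair2_measurable]. *)
Definition level_measure i : set tower -> \bar R :=
  image_measure (mrestr nu (measurable_roof_gt i)) (pair2_measurable i).

HB.instance Definition _ i := Measure.on (level_measure i).

Definition tower_premeasure : set tower -> \bar R := mseries level_measure 0.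

HB.instance Definition _ := Measure.on tower_premeasure.

Definition tower_measure : set tower -> \bar R :=
  mnormalize tower_premeasure (dirac point).

HB.instance Definition _ := Probability.on tower_measure.

Lemma tower_premeasureE A : tower_premeasure A =
  (\sum_(i <oo) nu (level A i `&` roof @^-1` [set n | (i < n)%N]))%E.
Proof. by []. Qed.

End Tower.

(** * Invariance, ergodicity and nontriviality of the tower *)

Section TowerMeasure.
Local Open Scope classical_set_scope.
Local Open Scope ereal_scope.
Variable R : realType.
Local Notation roof := (roof R).
Local Notation nu := (odo_measure R).
Local Notation tower := (oseq * nat)%type.
Local Notation m0 := (tower_premeasure R).
Local Notation mu := (tower_measure R).
Local Notation above i := (roof @^-1` [set n | (i < n)%N] : set oseq).

Lemma roof_gt0_set : above 0 = setT.
Proof. by apply/seteqP; split => // y _ /=; exact: roof_ge1. Qed.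

Lemma odo_measure_above_le i : nu (above i) <= ((2 ^- i)%:E).
Proof.
apply: le_trans (_ : nu (cyl i (2 ^ i).-1) <= _).
  apply: le_measure; rewrite ?inE; [exact: measurable_roof|exact: measurable_cyl|].
  by move=> y /= /roof_gt_all_ones /eqP.
by rewrite odo_measure_cyl// prednK// expn_gt0.
Qed.

Lemma tower_premeasureT_le : m0 setT <= 2%:E.
Proof.
apply: le_trans (epsilon_trick0 xpredT _) => //.
rewrite tower_premeasureE; apply: lee_nneseries => [i _ _|i _]; first exact: measure_ge0.
rewrite /level preimage_setT setTI; apply: le_trans (odo_measure_above_le i) _.
rewrite lee_fin natrX exprS invfM mulrA mulfV ?mul1r//.
Qed.

Lemma tower_premeasureT_ge : 1 <= m0 setT.
Proof.
rewrite tower_premeasureE; apply: le_trans (nneseries_lim_ge 1 _); last first.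
  by move=> *; exact: measure_ge0.
by rewrite big_nat1 /level preimage_setT setTI roof_gt0_set probability_setT.
Qed.

(** The total mass is at least 1, from level 0 alone, and at most 2, by a geometric series;
    normalising is thus multiplication by a constant. *)
Lemma tower_measureE : exists c : R, [/\ (0 < c <= 1)%R, m0 setT = (c^-1)%:E &
  forall A, mu A = m0 A * c%:E].
Proof.
have ge := tower_premeasureT_ge; have le := tower_premeasureT_le.
have fin : m0 setT \is a fin_num.
  by rewrite ge0_fin_numE ?measure_ge0// (le_lt_trans le) ?ltry.
exists ((fine (m0 setT))^-1)%R; rewrite -(fineK fin) lee_fin in ge.
have pos : (0 < fine (m0 setT))%R by rewrite (lt_le_trans _ ge).
split; first by rewrite invr_gt0 pos invf_le1.
  by rewrite invrK fineK.
move=> A; rewrite /tower_measure /mnormalize /= -[X in X == 0](fineK fin) eqe gt_eqF//=.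
by case: eqP => // h; rewrite h in fin.
Qed.

(** Level i of the preimage has mass a(i+1) from points moving up and b(i) from tops sent to the
    bottom; the b(i) add up to the mass of the [odo]-preimage of level 0, which is a(0). *)
Lemma tower_map_preserving (A : set tower) : measurable A ->
  mu (tower_map R @^-1` A) = mu A.
Proof.
move=> mA; have [c [_ _ muE]] := tower_measureE; rewrite !muE; congr (_ * _).
rewrite !tower_premeasureE.
pose a i := nu (level A i `&` above i).
pose b i := nu (roof @^-1` [set i.+1] `&` odo @^-1` level A 0).
have mo := odo_preimage_measurable (measurable_level 0 mA).
have a0 i : 0 <= a i by exact: measure_ge0.
have b0 i : 0 <= b i by exact: measure_ge0.
transitivity (\sum_(i <oo) (a i.+1 + b i)).
  apply: eq_eseriesr => i _; rewrite /a /b -measureU; first last.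
  - apply/seteqP; split => // y [[_ /= h] [h' _]]; move: h h' => /=; lia.
  - by apply: measurableI; [exact: measurable_roof|].
  - by apply: measurableI; [exact: measurable_level|exact: measurable_roof].
  congr (nu _); apply/seteqP; split => y; rewrite /level /tower_map /=.
    move=> [+ iy]; case: ltnP => h1; first by left.
    by case: eqP => h2; [right|lia].
  case=> [[h1 h2]|[h1 h2]]; first by rewrite h2; split => //; exact: ltnW.
  by rewrite -h1 ltnn eqxx.
rewrite nneseriesD// (nneseries_recl (f := a))// addeC; congr (_ + _).
  rewrite /a roof_gt0_set setIT -odo_preserving; last exact: measurable_level.
  rewrite (_ : odo @^-1` _ =
      \bigcup_i (roof @^-1` [set i.+1] `&` odo @^-1` level A 0)); last first.
    apply/seteqP; split => y /=; last by move=> [i _ [_ h]].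
    by move=> h; exists (roof y).-1 => //; split => //=; rewrite prednK// roof_ge1.
  rewrite measure_bigcup//; first by apply: eq_eseriesl => i; rewrite in_setT.
  - by move=> i _; apply: measurableI; [exact: measurable_roof|].
  - by apply/trivIsetP => i j _ _ ij; apply/seteqP; split => // y [[/= -> _] [[e] _]]; rewrite e eqxx in ij.
rewrite -(@nneseries_addn _ a 1)//.
by apply: eq_eseriesr => i _; rewrite addn1.
Qed.

Lemma tower_map_up (y : oseq) i : (i < roof y)%N -> iter i (tower_map R) (y, 0%N) = (y, i).
Proof.
elim: i => // i IH h; rewrite iterS IH; last exact: ltnW.
by rewrite /tower_map /= h.
Qed.

Lemma tower_map_over (y : oseq) : iter (roof y) (tower_map R) (y, 0%N) = (odo y, 0%N).
Proof.
have := roof_ge1 R y; case e : (roof y) => [//|n] _.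
by rewrite iterS tower_map_up ?e// /tower_map /= e ltnn eqxx.
Qed.

Lemma tower_map_invariant (A : set tower) (y : oseq) i : tower_map R @^-1` A = A ->
  (i < roof y)%N -> A (y, i) <-> A (y, 0%N).
Proof.
move=> TA iy; have it n x : A (iter n (tower_map R) x) <-> A x.
  by elim: n => //= n <-; rewrite -[in X in _ <-> X]TA.
by rewrite -(tower_map_up iy).
Qed.

(** Below the roof, an invariant set consists of the full vertical fibres over its trace on level 0,
    and this trace is [odo]-invariant, hence null or of full measure. *)
Lemma tower_ergodic : ergodic mu (tower_map R).
Proof.
move=> A mA TA; have [c [c01 m0T muE]] := tower_measureE.
suff : m0 A * c%:E = 0 \/ m0 A * c%:E = 1 by rewrite -muE.
have oE : odo @^-1` level A 0 = level A 0.
  have it n x : A (iter n (tower_map R) x) <-> A x.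
    by elim: n => //= n <-; rewrite -[in X in _ <-> X]TA.
  by apply/seteqP; split => y; rewrite /level /= -tower_map_over; move/it.
have -> : m0 A = \sum_(i <oo) nu (level A 0 `&` above i).
  rewrite tower_premeasureE; apply: eq_eseriesr => i _; congr (nu _).
  by apply/seteqP; split => y [h iy]; split => //; move: h; rewrite /level /= tower_map_invariant.
have mE := measurable_level 0 mA.
have mab i : measurable (above i) by exact: measurable_roof.
have [E0|E1] := odo_ergodic R mE oE; [left|right].
  rewrite eseries0 ?mul0e// => i _ _; apply/eqP; rewrite eq_le measure_ge0 andbT -E0.
  by apply: le_measure; rewrite ?inE//; exact: measurableI.
have -> : \sum_(i <oo) nu (level A 0 `&` above i) = m0 setT.
  rewrite tower_premeasureE; apply: eq_eseriesr => i _.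
  rewrite /level preimage_setT setTI.
  have E1c : nu (~` level A 0) = 0.
    transitivity (1 - nu (level A 0)); first exact: (probability_setC nu mE).
    by rewrite E1 subee.
  rewrite -[in RHS](setUIDK (above i) (level A 0)) measureU; first last.
  - by apply/seteqP; split => // y [[_ h] [_ h']].
  - exact: measurableD.
  - exact: measurableI.
  rewrite setIC [X in _ = _ + X](_ : _ = 0) ?adde0//.
  apply/eqP; rewrite eq_le measure_ge0 andbT -E1c.
  by apply: le_measure; rewrite ?inE; [exact: measurableD|exact: measurableC|move=> y []].
by rewrite m0T -EFinM mulVf// gt_eqF//; case/andP: c01.
Qed.

Lemma tower_premeasureX (B : set oseq) i : m0 (B `*` [set i]) = nu (B `&` above i).
Proof.
rewrite tower_premeasureE (nneseriesD1 (n := i))//.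
rewrite eseries0 ?adde0.
  by congr (nu (_ `&` _)); apply/seteqP; split => y; rewrite /level /=; [move=> []|].
move=> j _ /= ji; rewrite (_ : level _ j = set0) ?set0I ?measure0//.
by apply/seteqP; split => // y; rewrite /level /= => -[_ e]; rewrite e eqxx in ji.
Qed.

(** Level 0 over half of the odometer has measure c / 2 with 0 < c <= 1. *)
Lemma tower_nontrivial : nontrivial mu.
Proof.
have [c [/andP[c0 c1] m0T muE]] := tower_measureE.
exists (cyl 1 0 `*` [set 0%N]); split.
  by apply: measurableX => //; exact: measurable_cyl.
suff : 0 < m0 (cyl 1 0 `*` [set 0%N]) * c%:E /\ m0 (cyl 1 0 `*` [set 0%N]) * c%:E < 1.
  by rewrite -muE.
rewrite tower_premeasureX roof_gt0_set setIT odo_measure_cyl// -EFinM !lte_fin; split.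
  by rewrite mulr_gt0// invr_gt0 exprn_gt0.
by rewrite expr1; lra.
Qed.

End TowerMeasure.

(** * Closure properties of rigid sets *)

Section Rigidity.
Local Open Scope classical_set_scope.
Local Open Scope ereal_scope.
Context (R : realType) (d : measure_display) (X : measurableType d).
Variables (mu : probability X R) (T Tinv : X -> X).
Hypothesis mps : inv_mps mu T Tinv.

Let mT n (A : set X) : measurable A -> measurable (iter n T @^-1` A).
Proof.
case: mps => mT _ _ _ _ mA; elim: n => [//|n IH].
rewrite (_ : iter n.+1 T @^-1` A = T @^-1` (iter n T @^-1` A)).
  by rewrite -[X in measurable X]setTI; exact: mT.
by apply/seteqP; split => x; rewrite /= -iterSr.
Qed.

Let muT n (A : set X) : measurable A -> mu (iter n T @^-1` A) = mu A.
Proof.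
case: mps => _ _ _ _ pT mA; elim: n => [//|n IH].
rewrite (_ : iter n.+1 T @^-1` A = T @^-1` (iter n T @^-1` A)).
  by rewrite pT//; exact: mT.
by apply/seteqP; split => x; rewrite /= -iterSr.
Qed.

Let iterK n : cancel (iter n T) (iter n Tinv).
Proof. by case: mps => _ _ K _ _; elim: n => // n IH x; rewrite iterSr (iterS n T) K IH. Qed.

Let iterVK n : cancel (iter n Tinv) (iter n T).
Proof. by case: mps => _ _ _ K _; elim: n => // n IH x; rewrite iterSr (iterS n Tinv) K IH. Qed.

(** Only forward iterates and one-sided losses are tracked: by invariance the loss equals the gain,
    and the powers n and - n give the same value. *)
Definition escape n (A : set X) : \bar R := mu (A `\` iter n T @^-1` A).

Let escapeC n (A : set X) : measurable A -> mu (iter n T @^-1` A `\` A) = escape n A.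
Proof.
move=> mA; have mB := mT n mA; have lty B : measurable B -> mu B < +oo.
  by move=> mB'; rewrite (le_lt_trans (probability_le1 _ _)) ?ltry.
have e1 : mu (iter n T @^-1` A `\` A) = mu (iter n T @^-1` A) - mu (iter n T @^-1` A `&` A).
  by apply: measureD => //; exact: lty.
have e2 : mu (A `\` iter n T @^-1` A) = mu A - mu (A `&` iter n T @^-1` A).
  by apply: measureD => //; exact: lty.
by rewrite /escape e1 e2 muT// setIC.
Qed.

Lemma symdiff_escape (n : int) A : measurable A ->
  mu (symdiff A (tpow T Tinv n @` A)) = escape `|n|%N A + escape `|n|%N A.
Proof.
move=> mA.
have dj (B C : set X) : measurable B -> measurable C ->
    mu (symdiff B C) = mu (B `\` C) + mu (C `\` B).
  move=> mB mC; rewrite measureU//; try exact: measurableD.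
  by apply/seteqP; split => // x [[Bx Cx] [_ nBx]].
case: n => n /=.
  have -> : iter n T @` A = iter n Tinv @^-1` A.
    apply/seteqP; split => x /=; first by move=> [y Ay <-]; rewrite iterK.
    by move=> h; exists (iter n Tinv x) => //; exact: iterVK.
  have mB : measurable (iter n Tinv @^-1` A).
    case: mps => _ mTi _ _ _; elim: n => [//|n IH].
    rewrite (_ : iter n.+1 Tinv @^-1` A = Tinv @^-1` (iter n Tinv @^-1` A)).
      by rewrite -[X in measurable X]setTI; exact: mTi.
    by apply/seteqP; split => x; rewrite /= -iterSr.
  set B := iter n Tinv @^-1` A in mB *.
  have TB : iter n T @^-1` B = A by apply/seteqP; split => x; rewrite /B /= iterK.
  rewrite dj// -{1}TB escapeC// /escape TB.
  have h : mu (B `\` A) = escape n A.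
    have BT x : B (iter n T x) = A x by rewrite /B /= iterK.
    rewrite -(muT n (measurableD mB mA)) /escape; congr (mu _).
    by apply/seteqP; split => x [/= h1 h2]; split => //=; move: h1; rewrite BT.
  by rewrite h.
(* [Negz n] stands for -(n + 1), whose image is the preimage under [iter n.+1 T]. *)
have -> : (Tinv \o iter n Tinv) @` A = iter n.+1 T @^-1` A.
  apply/seteqP; split => x; first by move=> [y Ay <-]; have := iterVK n.+1 y; rewrite /preimage /= => ->.
  by move=> h; exists (iter n.+1 T x) => //; exact: (iterK n.+1 x).
by rewrite (dj _ _ mA (mT n.+1 mA)) (escapeC n.+1 mA).
Qed.

Definition rigid_set (S : set int) (A : set X) : Prop := measurable A /\
  forall e : R, (0 < e)%R -> finite_set [set n | S n /\ e%:E < escape `|n|%N A].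

Lemma rigid_set_along (S : set int) :
  (forall A, measurable A -> rigid_set S A) -> rigid_along S mu T Tinv.
Proof.
move=> h A mA e e0; have [_ /(_ (e / 2)%R)] := h A mA; rewrite divr_gt0// => /(_ isT).
apply: sub_finite_set => n [Sn]; rewrite symdiff_escape// => lt; split => //.
rewrite ltNge; apply/negP => le; move: lt; rewrite ltNge => /negP; apply.
by apply: le_trans (leeD le le) _; rewrite -EFinD lee_fin -splitr.
Qed.

(** Split e into thirds: a time at which A loses more than e is one at which B or C loses more than
    e / 3. *)
Lemma rigid_approx (S : set int) A : measurable A ->
  (forall e : R, (0 < e)%R -> exists B C, [/\ rigid_set S B, rigid_set S C &
     forall n, escape n A <= e%:E + (escape n B + escape n C)]) ->
  rigid_set S A.
Proof.
move=> mA h; split => // e e0.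
have e30 : (0 < e / 3)%R by rewrite divr_gt0.
have [B [C [[_ /(_ _ e30) hB] [_ /(_ _ e30) hC] le]]] := h _ e30.
apply: (@sub_finite_set _ _ ([set n | S n /\ (e / 3)%:E < escape `|n|%N B] `|`
  [set n | S n /\ (e / 3)%:E < escape `|n|%N C])); last by rewrite finite_setU.
move=> n [Sn lt] /=; apply: contrapT => /not_orP[nB nC].
have leB : escape `|n|%N B <= (e / 3)%:E.
  by rewrite leNgt; apply/negP => ?; apply: nB.
have leC : escape `|n|%N C <= (e / 3)%:E.
  by rewrite leNgt; apply/negP => ?; apply: nC.
move: lt; apply/negP; rewrite -leNgt; apply: le_trans (le _) _.
apply: le_trans (leeD (lexx _) (leeD leB leC)) _.
by rewrite -!EFinD lee_fin; lra.
Qed.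

Let subset_le (A B : set X) : measurable A -> measurable B -> A `<=` B -> mu A <= mu B.
Proof. by move=> mA mB AB; apply: le_measure; rewrite ?inE. Qed.

Let mescape n (A : set X) : measurable A -> measurable (A `\` iter n T @^-1` A).
Proof. by move=> mA; apply: measurableD => //; exact: mT. Qed.

Let subadd2 (A B : set X) : measurable A -> measurable B -> mu (A `|` B) <= mu A + mu B.
Proof. by move=> mA mB; exact: measureU2. Qed.

Lemma rigid_setU S A B : rigid_set S A -> rigid_set S B -> rigid_set S (A `|` B).
Proof.
move=> hA hB; have [mA _] := hA; have [mB _] := hB.
have mAB : measurable (A `|` B) by exact: measurableU.
apply: rigid_approx => // e e0; exists A, B; split => // n.
apply: (@le_trans _ _ (escape n A + escape n B)); last by rewrite leeDr// lee_fin ltW.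
apply: le_trans _ (subadd2 (mescape n mA) (mescape n mB)).
apply: subset_le; [exact: mescape|by apply: measurableU; exact: mescape|].
by move=> x [[Ax|Bx] /not_orP[nA nB]]; [left|right].
Qed.

(** A point leaving the difference leaves A or enters B, and entering B has the same measure as
    leaving it. *)
Lemma rigid_setD S A B : rigid_set S A -> rigid_set S B -> rigid_set S (A `\` B).
Proof.
move=> hA hB; have [mA _] := hA; have [mB _] := hB.
have mAB : measurable (A `\` B) by exact: measurableD.
apply: rigid_approx => // e e0; exists A, B; split => // n.
apply: (@le_trans _ _ (escape n A + escape n B)); last by rewrite leeDr// lee_fin ltW.
rewrite -(escapeC n mB).
have mB' : measurable (iter n T @^-1` B `\` B) by apply: measurableD => //; exact: mT.
apply: le_trans _ (subadd2 (mescape n mA) mB').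
apply: subset_le; [exact: mescape|by apply: measurableU => //; exact: mescape|].
move=> x [[Ax nBx] h]; have [Bx|nB] := pselect (B (iter n T x)); [by right|left].
by split => // Ax'; apply: h.
Qed.

(** With F N exhausting the union up to e, a point escaping the union lies outside F N or escapes F
    N. *)
Lemma rigid_set_ndseq S : ndseq_closed (rigid_set S).
Proof.
move=> F ndF hF; have mF i : measurable (F i) by have [] := hF i.
have mU : measurable (\bigcup_i F i) by exact: bigcup_measurable.
apply: rigid_approx => // e e0.
have fU : mu (\bigcup_i F i) \is a fin_num by exact: fin_num_measure.
have cv := @nondecreasing_cvg_mu _ _ _ mu F mF mU ndF.
have [N hN] : exists N, mu (\bigcup_i F i) - e%:E < mu (F N).
  have lt : mu (\bigcup_i F i) - e%:E < mu (\bigcup_i F i).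
    by rewrite lteBlDr// lteDl// lte_fin.
  apply: contrapT => /forallNP nle; move: lt; apply/negP; rewrite -leNgt.
  suff : limn (mu \o F) <= mu (\bigcup_i F i) - e%:E by rewrite (cvg_lim _ cv).
  apply: lime_le.
    by apply/cvg_ex; eexists; exact: cv.
  by apply: nearW => n; rewrite leNgt; apply/negP => h; apply: (nle n); exact: h.
(* The empty set, which loses nothing, fills the second slot of [rigid_approx]. *)
exists (F N), set0; split => //.
  split => // e' e'0; rewrite (_ : [set _ | _] = set0)//.
  apply/seteqP; split => // n [_]; rewrite /escape set0D measure0 lte_fin => h.
  by move: (lt_trans e'0 h); rewrite ltxx.
move=> n; rewrite [escape n set0](_ : _ = 0) ?adde0; last by rewrite /escape set0D measure0.
have mD : measurable (\bigcup_i F i `\` F N) by exact: measurableD.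
apply: (@le_trans _ _ (mu (\bigcup_i F i `\` F N) + escape n (F N))); last first.
  rewrite leeD2r//.
  have -> : mu (\bigcup_i F i `\` F N) = mu (\bigcup_i F i) - mu (F N).
    transitivity (mu (\bigcup_i F i) - mu (\bigcup_i F i `&` F N)).
      by apply: measureD => //; rewrite -ge0_fin_numE ?measure_ge0.
    by rewrite setIidr//; exact: bigcup_sup.
  have fN : mu (F N) \is a fin_num by exact: fin_num_measure.
  by rewrite leeBlDr// -leeBlDl// ltW.
apply: le_trans _ (subadd2 mD (mescape n (mF N))).
apply: subset_le; [exact: mescape|by apply: measurableU => //; exact: mescape|].
move=> x [[i _ Fx] h]; have [FN|nF] := pselect (F N x); last by left; split => //; exists i.
by right; split => // FN'; apply: h; exists N.
Qed.

End Rigidity.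

(** * Reduction to cylinders and the return of good points *)

Section TowerRigidity.
Local Open Scope classical_set_scope.
Variable R : realType.
Local Notation p k := (stage_bits (stages R k)).
Local Notation h k := (stage_height (stages R k)).
Local Notation H k := (stage_block k (stages R k)).
Local Notation l k := (stage_columns R k (stages R k)).
Local Notation bnd k := (stage_bound R k (stages R k)).
Local Notation roof := (roof R).
Local Notation nu := (odo_measure R).
Local Notation tower := (oseq * nat)%type.
Local Notation m0 := (tower_premeasure R).
Local Notation mu := (tower_measure R).
Local Notation T := (tower_map R).
Local Notation above i := (roof @^-1` [set n | (i < n)%N] : set oseq).
Local Notation rigid := (rigid_set mu T).
#[local] Opaque stages stage_columns.

Lemma tower_mps : inv_mps mu T (tower_inv R).
Proof.
split.
- exact: measurable_tower_map.
- exact: measurable_tower_inv.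
- exact: tower_mapK.
- exact: tower_invK.
- exact: tower_map_preserving.
Qed.

Lemma setX1_bigcup (F : nat -> set oseq) (i : nat) :
  (\bigcup_n F n) `*` [set i] = \bigcup_n (F n `*` [set i]) :> set tower.
Proof.
apply/seteqP; split => -[y j] /=; first by move=> [[n _ Fy] ij]; exists n.
by move=> [n _ [Fy ij]]; split => //; exists n.
Qed.

(** On one level the bases of rigid sets form a lambda-system containing the pi-system of cylinders;
    a general D is the increasing union of its parts below height n. *)
Lemma rigid_of_cylinders S :
  (forall q a i, rigid S (cyl q a `*` [set i])) ->
  forall D, measurable D -> rigid S D.
Proof.
move=> hcyl.
have lev i (B : set oseq) : measurable B -> rigid S (B `*` [set i]).
  move: B; apply: (@lambda_system_subset _ cyls cyls_setI setT
    [set B : set oseq | rigid S (B `*` [set i])]) => //; last first.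
    by move=> _ [q [a ->]]; exact: hcyl.
  split => //.
  - by have := hcyl 0%N 0%N i; rewrite cyl0.
  - move=> A B BA hA hB.
    rewrite /= (_ : _ `*` _ = (A `*` [set i]) `\` (B `*` [set i])).
      exact: (rigid_setD tower_mps).
    apply/seteqP; split => -[y j] /=; first by move=> [[Ay nBy] ij]; split => // -[].
    by move=> [[Ay ij] nB]; split => //; split => // By; apply: nB.
  - move=> F ndF hF /=; rewrite setX1_bigcup; apply: (rigid_set_ndseq tower_mps) => //.
    move=> m n mn; apply/subsetPset => -[y j] [Fy ij]; split => //.
    by have /subsetPset := ndF _ _ mn; apply.
move=> D mD.
pose F n := D `&` [set x : tower | (x.2 < n)%N].
have -> : D = \bigcup_n F n.
  apply/seteqP; split => [x Dx|x [n _ []]//].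
  by exists x.2.+1 => //; split => //=.
apply: (rigid_set_ndseq tower_mps).
  move=> m n mn; apply/subsetPset => x [Dx /= xm]; split => //=; exact: leq_trans mn.
elim=> [|n IH].
  rewrite (_ : F 0%N = set0 `*` [set 0%N]); first by apply: lev; exact: measurable0.
  by apply/seteqP; split => // x [].
rewrite (_ : F n.+1 = F n `|` (level D n `*` [set n])).
  by apply: (rigid_setU tower_mps) => //; apply: lev; exact: measurable_level.
apply/seteqP; split => -[y i].
  move=> [Dx /=]; rewrite ltnS leq_eqVlt => /predU1P[ein|lt]; last by left; split.
  by right; split => //; rewrite /level /= -ein.
move=> [[Dx /= lt]|[Dx /= ->]]; split => //=; exact: ltnW.
Qed.

(** The point is i steps above the bottom and iterates commute, so the bottom can be moved first and
    climbed from afterwards. *)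
Lemma tower_map_return m (y : oseq) i :
  (i < roof y)%N -> (i < roof (iter m odo y))%N ->
  iter (roof_sum R m y) T (y, i) = (iter m odo y, i).
Proof.
move=> iy im; rewrite -(tower_map_up iy) -iterD addnC iterD.
rewrite (_ : iter (roof_sum R m y) T (y, 0%N) = (iter m odo y, 0%N)).
  exact: tower_map_up.
elim: m {im} => [|m IH]; first by rewrite /roof_sum big_ord0.
rewrite /roof_sum big_ord_recr /= addnC iterD -/(roof_sum R m y) IH.
exact: tower_map_over.
Qed.

(** The bits from q to q + m - 1 spell c. *)
Definition slice (q m c : nat) : set oseq := [set y | (bval (q + m) y %/ 2 ^ q = c)%N].

Lemma sliceE q m c :
  slice q m c = \big[setU/set0]_(r < (2 ^ q)%N) cyl (q + m)%N (c * 2 ^ q + r)%N.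
Proof.
rewrite -(bigcup_mkord _ (fun r => cyl (q + m) (c * 2 ^ q + r)%N)).
apply/seteqP; split => y; rewrite /slice /=.
  move=> <-; exists (bval (q + m) y %% 2 ^ q)%N; first by rewrite /= ltn_pmod// expn_gt0.
  by rewrite /cyl /= -divn_eq.
move=> [r /= rq]; rewrite /cyl /= => ->.
by rewrite divnMDl ?expn_gt0// divn_small// addn0.
Qed.

Lemma measurable_slice q m c : measurable (slice q m c).
Proof. by rewrite sliceE; apply: bigsetU_measurable => i _; exact: measurable_cyl. Qed.

Lemma odo_measure_bigsetU n (A : (set oseq)^nat) : (forall i, measurable (A i)) ->
  (nu (\big[setU/set0]_(i < n) A i) <= \sum_(i < n) nu (A i))%E.
Proof. by move=> mA; exact: Boole_inequality. Qed.

Lemma odo_measure_slice_le q m c : (nu (slice q m c) <= (2 ^- m)%:E)%E.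
Proof.
rewrite sliceE.
apply: le_trans (odo_measure_bigsetU (2 ^ q)%N (fun r => measurable_cyl _ (c * 2 ^ q + r)%N)) _.
apply: (@le_trans _ _ (\sum_(r < (2 ^ q)%N) (2 ^- (q + m))%:E)%E).
  apply: lee_sum => r _; have [lt|ge] := ltnP (c * 2 ^ q + r) (2 ^ (q + m)).
    by rewrite odo_measure_cyl.
  by rewrite cyl_empty// measure0 lee_fin invr_ge0 exprn_ge0.
rewrite sumEFin lee_fin sumr_const card_ord -[X in X <= _]mulr_natl natrX exprD invfM mulrA.
by rewrite mulfV ?mul1r// expf_neq0.
Qed.

Definition bad_chunk (k n j : nat) : set oseq :=
  if (H k j %| n)%N then set0 else slice (p k + l k) k j.

(** Columns are counted from the end of the chunk, b = 0 being the last, in all chunks at once. *)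
Definition bad_column (k b : nat) : set oseq :=
  slice (p k) (l k) (2 ^ l k - b.+1)%N.

(* Outside this set, [tower_map] iterated [n] times keeps the height of a point and
   moves its base point by a multiple of [2 ^ p k]. *)
Definition bad_set (k n : nat) : set oseq :=
  cyl (p k) (2 ^ p k).-1 `|`
  (\big[setU/set0]_(j < (2 ^ k)%N) bad_chunk k n j `|`
   \big[setU/set0]_(b < bnd k) bad_column k b).

Lemma measurable_bad_chunk k n j : measurable (bad_chunk k n j).
Proof.
by rewrite /bad_chunk; case: ifP => _; [exact: (@measurable0 _ oseq)|exact: measurable_slice].
Qed.

Lemma measurable_bad_column k b : measurable (bad_column k b).
Proof. exact: measurable_slice. Qed.

Lemma measurable_bad_set k n : measurable (bad_set k n).
Proof.
apply: (@measurableU _ oseq); first exact: measurable_cyl.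
apply: (@measurableU _ oseq); apply: (@bigsetU_measurable _ oseq) => i _.
  exact: measurable_bad_chunk.
exact: measurable_bad_column.
Qed.

(** The column height divides n, and the quotient, at most [bnd k], is a number of passes that fits
    in the chunk. The low bits are not all ones, so the roof at the new base point is the same. *)
Lemma bad_set_return k n (y : oseq) i : (n <= bnd k)%N -> ~ bad_set k n y ->
  (i < roof y)%N -> exists q, iter n T (y, i) = (iter (q * 2 ^ p k) odo y, i).
Proof.
move=> nB /not_orP[h1 /not_orP[h2 h3]] iy.
have ao : ~~ all_ones (p k) y by apply/eqP.
set a := bval (p k.+1) y.
have jk : (a %/ 2 ^ (p k + l k) < 2 ^ k)%N.
  rewrite ltn_divLR ?expn_gt0// (expnD _ (p k)) (mulnC (expn 2 (p k))) mulnA.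
  by rewrite -expn_stages_bitsS; exact: bval_lt.
have Hn : (H k (a %/ 2 ^ (p k + l k)) %| n)%N.
  apply: contrapT => /negP Hn; apply: h2; rewrite -bigcup_mkord.
  by exists (a %/ 2 ^ (p k + l k))%N => //; rewrite /bad_chunk (negbTE Hn).
have col : ((a %/ 2 ^ p k) %% 2 ^ l k + bnd k < 2 ^ l k)%N.
  rewrite ltnNge; apply/negP => le; apply: h3; rewrite -bigcup_mkord.
  have lt : ((a %/ 2 ^ p k) %% 2 ^ l k < 2 ^ l k)%N by rewrite ltn_pmod// expn_gt0.
  exists (2 ^ l k - ((a %/ 2 ^ p k) %% 2 ^ l k).+1)%N => /=; first by lia.
  rewrite /bad_column /slice /=.
  have -> : bval (p k + l k) y = (a %% 2 ^ (p k + l k))%N.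
    by rewrite bval_mod// stages_bitsS leq_addr.
  by rewrite (expnD _ (p k)) (mulnC (expn 2 (p k))) -modn_divl; lia.
exists (n %/ H k (a %/ 2 ^ (p k + l k)))%N.
rewrite -{1}(divnK Hn) -roof_sum_block; last first.
  apply: leq_ltn_trans col; rewrite leq_add2l; apply: leq_trans nB; exact: leq_div.
by rewrite tower_map_return// roof_iter_odo.
Qed.

End TowerRigidity.

(** * The rigidity times: smallness of bad sets, density and rigidity *)

Section RigidityTimes.
Local Open Scope classical_set_scope.
Variable R : realType.
Local Notation p k := (stage_bits (stages R k)).
Local Notation h k := (stage_height (stages R k)).
Local Notation H k := (stage_block k (stages R k)).
Local Notation l k := (stage_columns R k (stages R k)).
Local Notation bnd k := (stage_bound R k (stages R k)).
Local Notation roof := (roof R).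
Local Notation nu := (odo_measure R).
Local Notation tower := (oseq * nat)%type.
Local Notation mu := (tower_measure R).
Local Notation T := (tower_map R).
#[local] Opaque stages stage_columns.

(** The terms are 2 ^- k for the all-ones cylinder, 2 ^- k for each of at most 2 k ^ 2 chunks, and 2
    ^- k for the columns, because bnd k * 2 ^ k <= 2 ^ l k. *)
Lemma odo_measure_bad_set k n :
  (#|[pred j : 'I_(2 ^ k) | ~~ (H k j %| n)%N]| <= 2 * k ^ 2)%N ->
  (nu (bad_set R k n) <= ((2 * k ^ 2 + 2)%:R / 2 ^+ k)%:E)%E.
Proof.
move=> hbad.
have mcol : measurable (\big[setU/set0]_(b < bnd k) bad_column R k b).
  by apply: (@bigsetU_measurable _ oseq) => i _; exact: measurable_bad_column.
have mchk : measurable (\big[setU/set0]_(j < (2 ^ k)%N) bad_chunk R k n j).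
  by apply: (@bigsetU_measurable _ oseq) => i _; exact: measurable_bad_chunk.
have m1 := measurable_cyl (p k) (2 ^ p k).-1.
have u2 (A B : set oseq) : measurable A -> measurable B -> (nu (A `|` B) <= nu A + nu B)%E.
  by move=> mA mB; exact: measureU2.
have -> : (2 * k ^ 2 + 2)%:R / 2 ^+ k =
    2 ^- k + ((2 * k ^ 2)%:R / 2 ^+ k + 2 ^- k) :> R by rewrite natrD; lra.
apply: le_trans (u2 _ _ m1 (measurableU _ _ mchk mcol)) _.
rewrite EFinD; apply: leeD.
  rewrite odo_measure_cyl ?prednK ?expn_gt0// lee_fin lef_pV2 ?posrE ?exprn_gt0//.
  by rewrite ler_eXn2l ?ltr1n// ltnW// bits_gt.
apply: le_trans (u2 _ _ mchk mcol) _; rewrite EFinD; apply: leeD.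
  apply: le_trans (odo_measure_bigsetU _ _ (measurable_bad_chunk R k n)) _.
  apply: (@le_trans _ _ (\sum_(j < (2 ^ k)%N) ((~~ (H k j %| n)%N)%:R * 2 ^- k)%:E)%E).
    apply: lee_sum => j _; rewrite /bad_chunk; case: ifP => _ /=.
      by rewrite measure0 mul0r.
    by rewrite mul1r odo_measure_slice_le.
  rewrite sumEFin lee_fin -big_distrl /= ler_pM2r ?invr_gt0 ?exprn_gt0//.
  by rewrite -natr_sum ler_nat -big_mkcond sum1_card.
apply: le_trans (odo_measure_bigsetU _ _ (measurable_bad_column R k)) _.
apply: (@le_trans _ _ (\sum_(b < bnd k) (2 ^- l k)%:E)%E).
  by apply: lee_sum => b _; exact: odo_measure_slice_le.
rewrite sumEFin lee_fin sumr_const card_ord -[X in X <= _]mulr_natl.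
rewrite ler_pdivrMr ?exprn_gt0// mulrC ler_pdivlMr ?exprn_gt0// mulrC -!natrX -natrM ler_nat.
apply: (@leq_trans (2 ^ (k + bnd k))); last by rewrite leq_exp2l// stage_columns_ge.
by rewrite expnD leq_mul2l ltnW ?orbT// ltn_expl.
Qed.

(** Off the bad set a point under the roof keeps its height, and its base moves by a multiple of 2 ^
    p k, which preserves the low q bits. Points above the roof carry no mass. *)
Lemma escape_cyl_le k n q a i : (q <= p k)%N -> (n <= bnd k)%N ->
  (escape mu T n (cyl q a `*` [set i]) <= nu (bad_set R k n))%E.
Proof.
move=> qk nB; have [c [/andP[c0 c1] _ muE]] := tower_measureE R.
pose above := roof @^-1` [set n | (i < n)%N] : set oseq.
have ma : measurable above by exact: measurable_roof.
have mb := measurable_bad_set R k n.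
pose B := bad_set R k n `|` ~` above.
have mB : measurable B by apply: (@measurableU _ oseq) => //; exact: (@measurableC _ oseq).
have mBX : measurable (B `*` [set i] : set tower) by apply: measurableX.
have mC : measurable (cyl q a `*` [set i] : set tower).
  by apply: measurableX => //; exact: measurable_cyl.
have le1 : (tower_measure R (B `*` [set i]) <= nu (bad_set R k n))%E.
  rewrite muE tower_premeasureX.
  apply: (@le_trans _ _ (nu (B `&` above))).
    by rewrite -[leRHS]mule1; apply: lee_wpmul2l; rewrite ?measure_ge0// lee_fin.
  apply: le_measure; rewrite ?inE//; first exact: (@measurableI _ oseq).
  by move=> y [[//|na] ay]; exfalso; exact: na.
apply: le_trans _ le1; apply: le_measure; rewrite ?inE//.
  apply: measurableD => //.
  have mi : forall m (A : set tower), measurable A -> measurable (iter m T @^-1` A).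
    move=> m A mA; elim: m => [//|m IH].
    rewrite (_ : iter m.+1 T @^-1` A = T @^-1` (iter m T @^-1` A)).
      by rewrite -[X in measurable X]setTI; exact: measurable_tower_map.
    by apply/seteqP; split => x; rewrite /= -iterSr.
  exact: mi.
move=> [y j] [[/= ya ->] nT]; split => //=.
have [ay|na] := pselect (above y); last by right.
left; apply: contrapT => nbad; apply: nT.
have [m ->] := bad_set_return nB nbad ay.
split => //=; rewrite /cyl /= bval_iter_odo -ya.
by rewrite -(subnK qk) expnD mulnA addnC modnMDl modn_small// bval_lt.
Qed.

Lemma poly_exp_small (e : R) : 0 < e ->
  exists N, forall k, (N <= k)%N -> (2 * k ^ 2 + 2)%:R / 2 ^+ k < e.
Proof.
move=> e0.
(* For k >= 10 and k > 4 / e, one has 2 k ^ 2 + 2 <= 4 k ^ 2 < e k ^ 3 <= e 2 ^ k. *)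
have cube k : (10 <= k)%N -> (k ^ 3 <= 2 ^ k)%N.
  elim: k => // k IH; rewrite leq_eqVlt => /predU1P[<-//|]; rewrite ltnS => k10.
  by have := IH k10; rewrite !expnS expn0; nia.
have [N hN] : exists N : nat, 4 / e < N%:R by exists (Num.bound (4 / e)); apply: archi_boundP; rewrite divr_ge0// ltW.
exists (maxn 10 N) => k; rewrite geq_max => /andP[k10 Nk].
have k0 : 0 < k%:R :> R by rewrite ltr0n; lia.
rewrite ltr_pdivrMr ?exprn_gt0//.
have : (4 * k ^ 2)%:R < e * (k ^ 3)%:R.
  have : 4 < e * k%:R.
    rewrite -ltr_pdivrMl//; apply: lt_le_trans (_ : N%:R <= _); last by rewrite ler_nat.
    by rewrite mulrC.
  have -> : (k ^ 3 = k * k ^ 2)%N by rewrite expnS.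
  move=> lt; rewrite (natrM _ 4) (natrM _ k) mulrA ltr_pM2r// ltr0n expn_gt0; lia.
have : (2 * k ^ 2 + 2)%:R <= (4 * k ^ 2)%:R :> R by rewrite ler_nat; nia.
have : e * (k ^ 3)%:R <= e * 2 ^+ k by rewrite ler_pM2l// -natrX ler_nat cube.
lra.
Qed.

Definition rigidity_times : set int := [set n : int | exists k,
  (`|n| <= bnd k)%N /\ (#|[pred j : 'I_(2 ^ k) | ~~ ((H k j)%:Z %| n)%Z]| <= 2 * k ^ 2)%N].

Lemma rigidity_times_dense : bohr_dense R rigidity_times.
Proof.
move=> U oU [m Um]; have [q [chi [e [e0 [hchi hU]]]]] := oU m Um.
have [N hN] := poly_exp_small e0.
(* The stage must accommodate the tolerance, the number of characters and the size of m. *)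
pose k := maxn N (maxn q `|m|).
have hcop i j : (i < 2 ^ k)%N -> (j < 2 ^ k)%N -> i != j -> coprime (H k i) (H k j).
  exact: block_height_coprime.
have [n [nB nH hn]] : exists n : int, [/\ (`|n| <= bnd k)%N,
    (#|[pred j : 'I_(2 ^ k) | ~~ ((H k j)%:Z %| n)%Z]| <= 2 * k ^ 2)%N &
    forall i, near_int (2%:R ^- k : R) (chi i (n - m))].
  apply: (stage_bounded hcop) => //; first by rewrite /k; lia.
  by rewrite /k; lia.
exists n; split; first by exists k.
apply: hU => i; apply: (@tnorm_lt _ (2 ^- k)); last first.
  (* Since 2 k ^ 2 + 2 >= 1, the bound on (2 k ^ 2 + 2) / 2 ^ k also bounds 2 ^- k. *)
  apply: le_lt_trans (hN k _); last by rewrite /k leq_maxl.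
  by rewrite ler_peMl ?invr_ge0 ?exprn_ge0// ler1n addn2.
have [z hz] := torus_homB (hchi i) n m.
by apply: near_int_shift (hn i); exists (- z); rewrite hz rmorphN /= addrK.
Qed.

Lemma rigidity_times_infinite : ~ finite_set rigidity_times.
Proof.
move=> fin.
have big k : exists2 n : nat, (k < n)%N & rigidity_times n.
  (* The product is divisible by every height and bounded by [bnd k]; its factor [H k 0] exceeds
     [h k] >= 2 ^ p k > k. *)
  exists (\prod_(j < (2 ^ k)%N) H k j)%N.
    have k0 : (0 < 2 ^ k)%N by rewrite expn_gt0.
    rewrite (bigD1 (Ordinal k0)) //=; apply: (@leq_trans (H k 0%N)).
      apply: leq_trans (block_height_gt _ _ _).
      apply: (@leq_trans (2 ^ p k)%N).
        by apply: ltn_trans (ltn_expl _ _) => //; exact: bits_gt.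
      have : (\sum_(a < (2 ^ p k)%N) 1 <= h k)%N by apply: leq_sum => a _; exact: roof_gt0.
      by rewrite sum1_card card_ord => /leqW.
    rewrite leq_pmulr// prodn_gt0// => j.
    exact: leq_ltn_trans (leq0n _) (block_height_gt _ _ _).
  exists k; split; first by rewrite absz_nat stage_bound_ge.
  rewrite eq_card0// => j; rewrite !inE; apply/negbTE; rewrite negbK.
  by rewrite dvdzE /= (bigD1 j)//= dvdn_mulr.
have /finite_seqP[X hX] := fin.
have [n nX hn] := big (\max_(x <- X) `|x|%N).
have nX' : n%:Z \in X by move: hn; rewrite hX.
by have := @leq_bigmax_seq _ X xpredT absz _ nX' isT; rewrite leqNgt absz_nat nX.
Qed.

(** Times coming from a late stage lose less than e on a given cylinder; the finitely many earlier
    stages contribute only times bounded by M. *)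
Lemma tower_rigid_along : rigid_along rigidity_times mu T (tower_inv R).
Proof.
apply: (rigid_set_along (tower_mps R)); apply: rigid_of_cylinders => q a i.
split; first by apply: measurableX => //; exact: measurable_cyl.
move=> e e0; have [N hN] := poly_exp_small e0.
pose K := maxn N q; pose M := (\max_(k < K) bnd k)%N.
apply: (@sub_finite_set _ _ [set` [seq x - M%:Z | x <- map Posz (iota 0 (M + M).+1)]]);
  last exact: finite_seq.
move=> n [[k [nB nH]] lt].
have kK : (k < K)%N.
  rewrite ltnNge; apply/negP => Kk; move: lt; apply/negP; rewrite -leNgt.
  have qk : (q <= p k)%N.
    by apply: leq_trans (ltnW (bits_gt R k)); apply: leq_trans Kk; exact: leq_maxr.
  apply: le_trans (escape_cyl_le a i qk nB) _.
  apply: le_trans (odo_measure_bad_set _) _.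
    by apply: leq_trans nH; rewrite leq_eqVlt; apply/orP; left; apply/eqP; apply: eq_card.
  by rewrite lee_fin ltW// hN// (leq_trans _ Kk)// leq_maxl.
have nM : (`|n| <= M)%N.
  exact: leq_trans nB (leq_bigmax (Ordinal kK)).
apply/mapP; exists (n + M%:Z); last by rewrite addrK.
apply/mapP; exists (absz (n + M%:Z)); last by move: nM; rewrite /=; lia.
by rewrite mem_iota; move: nM; lia.
Qed.

End RigidityTimes.

Theorem theorem5p4 (R : realType) :
  exists S : set int, set_of_rigidity R S /\ bohr_dense R S.
Proof.
exists (rigidity_times R); split; last exact: rigidity_times_dense.
split; first exact: rigidity_times_infinite.
exists _, (oseq * nat)%type, (tower_measure R), (tower_map R), (tower_inv R).
split.
- exact: tower_mps.
- exact: tower_ergodic.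
- exact: tower_nontrivial.
- exact: tower_rigid_along.
Qed.
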